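(* Let the plant $(A,B,C)$ and the weights $W,V,Q,R$ be such that $(A,B)$ and $(A,W^{1/2})$ are controllable, and $(C,A)$ and $(Q^{1/2},A)$ are observable. Then the following statements are true. 1) $\mathcal{C}_n$ is path-connected if there exists a reduced-order stabilizing controller, i.e., if $\mathcal{C}_{n-1}\neq\varnothing$. 2) Suppose the plant is single-input or single-output, i.e., $m=1$ or $p=1$. Then $\mathcal{C}_n$ is path-connected if and only if $\mathcal{C}_{n-1}\neq\varnothing$.
   Context: Fix integers $n,m,p\ge 1$, real matrices $A\in\mathbb{R}^{n\times n}$, $B\in\mathbb{R}^{n\times m}$, $C\in\mathbb{R}^{p\times n}$ (the plant $\dot x=Ax+Bu+w$, $y=Cx+v$), and real symmetric matrices $W\succeq 0$ ($n\times n$), $V\succ 0$ ($p\times p$), $Q\succeq 0$ ($n\times n$), $R\succ 0$ ($m\times m$). A real square matrix is called stable if all its eigenvalues have negative real part. For $q\ge 1$, the set of strictly proper stabilizing controllers of order $q$ is $$\mathcal{C}_q=\left\{\mathsf{K}=\begin{bmatrix}0_{m\times p}&C_{\mathsf K}\\ B_{\mathsf K}&A_{\mathsf K}\end{bmatrix}\in\mathbb{R}^{(m+q)\times(p+q)}\ \middle|\ A_{\mathsf K}\in\mathbb{R}^{q\times q},\,B_{\mathsf K}\in\mathbb{R}^{q\times p},\,C_{\mathsf K}\in\mathbb{R}^{m\times q},\ \begin{bmatrix}A&BC_{\mathsf K}\\ B_{\mathsf K}C&A_{\mathsf K}\end{bmatrix}\text{ is stable}\right\},$$ with the topology induced from the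 Euclidean space of matrices. For $q=0$: $\mathcal{C}_0=\{0_{m\times p}\}$ if $A$ is stable, and $\mathcal{C}_0=\varnothing$ otherwise. *)

(* Defs.v *)
From HB Require Import structures.
From mathcomp Require Import all_boot all_order all_algebra.
From mathcomp Require Import all_classical all_reals all_analysis.
From mathcomp Require Import complex.

Set Implicit Arguments.
Unset Strict Implicit.
Unset Printing Implicit Defensive.

Import Order.TTheory GRing.Theory Num.Theory.
Import numFieldNormedType.Exports.

Local Open Scope classical_set_scope.
Local Open Scope ring_scope.

Definition posdef (R : realType) (n : nat) (M : 'M[R]_n) : Prop :=
  M^T = M /\ forall x : 'cV[R]_n, x != 0 -> 0 < (x^T *m M *m x) 0 0.

Definition possemidef (R : realType) (n : nat) (M : 'M[R]_n) : Prop :=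
  M^T = M /\ forall x : 'cV[R]_n, 0 <= (x^T *m M *m x) 0 0.

(* [S] is the (unique) positive semidefinite square root of [M]. *)
Definition is_psd_sqrt (R : realType) (n : nat) (M S : 'M[R]_n) : Prop :=
  possemidef S /\ S *m S = M.

(* The eigenvalues of a real matrix are its complex ones. *)
Definition stable (R : realType) (n : nat) (M : 'M[R]_n) : Prop :=
  forall a : complex R,
    eigenvalue (map_mx (real_complex R) M) a -> complex.Re a < 0.

(* Kalman's [B, A B, ..., A^(n-1) B] has full row rank. *)
Definition controllable (R : realType) (n m : nat)
    (A : 'M[R]_n) (B : 'M[R]_(n, m)) : Prop :=
  \rank (\mxrow_(j < n) (A ^+ j *m B)) = n.

(* [C; C A; ...; C A^(n-1)] has full column rank. *)
Definition observable (R : realType) (n p : nat)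
    (C : 'M[R]_(p, n)) (A : 'M[R]_n) : Prop :=
  \rank (\mxcol_(i < n) (C *m A ^+ i)) = n.

Definition closed_loop (R : realType) (n m p q : nat)
    (A : 'M[R]_n) (B : 'M[R]_(n, m)) (C : 'M[R]_(p, n))
    (AK : 'M[R]_q) (BK : 'M[R]_(q, p)) (CK : 'M[R]_(m, q)) : 'M[R]_(n + q) :=
  block_mx A (B *m CK) (BK *m C) AK.

(* The case [q = 0], where the blocks AK, BK, CK are empty, is spelled out in
   [stabilizing_controllers0] below. *)
Definition stabilizing_controllers (R : realType) (n m p : nat)
    (A : 'M[R]_n) (B : 'M[R]_(n, m)) (C : 'M[R]_(p, n)) (q : nat) :
    set 'M[R]_(m + q, p + q) :=
  [set K | exists (AK : 'M[R]_q) (BK : 'M[R]_(q, p)) (CK : 'M[R]_(m, q)),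
     K = block_mx 0 CK BK AK /\ stable (closed_loop A B C AK BK CK)].

(* [set] being transparent, [q] would otherwise be inferred from a member. *)
Arguments stabilizing_controllers {R n m p} A B C q _.

Definition path_connected (R : realType) (T : topologicalType) (S : set T) :
    Prop :=
  forall x y : T, S x -> S y ->
    exists f : R -> T,
      [/\ {within `[0, 1], continuous f}, f 0 = x, f 1 = y &
          forall t : R, 0 <= t <= 1 -> S (f t)].

Lemma stable_closed_loop0 (R : realType) (n m p : nat)
    (A : 'M[R]_n) (B : 'M[R]_(n, m)) (C : 'M[R]_(p, n))
    (AK : 'M[R]_0) (BK : 'M[R]_(0, p)) (CK : 'M[R]_(m, 0)) :
  stable (closed_loop A B C AK BK CK) <-> stable A.
Proof.
rewrite /stable /closed_loop.
suff E a : eigenvalue (map_mx (real_complex R)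
    (block_mx A (B *m CK) (BK *m C) AK)) a =
    eigenvalue (map_mx (real_complex R) A) a.
  by split=> h a; move: (h a); rewrite E.
rewrite !eigenvalue_root_char; congr (root _ a).
rewrite map_block_mx /char_poly /char_poly_mx map_block_mx scalar_mx_block.
rewrite opp_block_mx add_block_mx [X in block_mx _ X _ _]thinmx0.
by rewrite det_lblock det_mx00 mulr1.
Qed.

Lemma stabilizing_controllers0 (R : realType) (n m p : nat)
    (A : 'M[R]_n) (B : 'M[R]_(n, m)) (C : 'M[R]_(p, n)) :
  stabilizing_controllers A B C 0 = [set K | K = 0 /\ stable A].
Proof.
apply/seteqP; split=> K /=.
  move=> [AK [BK [CK [-> /stable_closed_loop0 sA]]]]; split=> //.
  by rewrite [CK]thinmx0 [BK]flatmx0 [AK]flatmx0 block_mx0.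
move=> [-> sA]; exists 0, 0, 0; split; first by rewrite block_mx0.
exact/stable_closed_loop0.
Qed.

(* Main.v *)
Require Import Defs.
From HB Require Import structures.
From mathcomp Require Import all_boot all_order all_algebra.
From mathcomp Require Import all_classical all_reals all_analysis.
From mathcomp Require Import complex.
From mathcomp Require Import perm spectral sesquilinear ring lra.

(* A full-order stabilizing controller amounts to a point of a convex set (a pair
   of linear matrix inequalities) together with an arbitrary invertible matrix [P]
   acting by change of coordinates.  Hence two controllers whose matrices [P] have
   determinants of the same sign are joined by a path.  A controller of order
   [n - 1], augmented by a decoupled stable mode, is fixed by the reflection of that
   mode, so that it carries matrices [P] of both signs and joins everything.
   Conversely, if [p = 1], reflecting a controller changes the sign of the
   determinant of its controllability matrix; on a path to its reflection some
   controller is therefore uncontrollable, and restricting it to its reachable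
   subspace gives a stabilizing controller of lower order.  The case [m = 1] is
   dual. *)

Set Implicit Arguments.
Unset Strict Implicit.
Unset Printing Implicit Defensive.

Import Order.TTheory GRing.Theory Num.Theory.
Import numFieldNormedType.Exports.

Local Open Scope classical_set_scope.
Local Open Scope ring_scope.

(** Stability is handled through Lyapunov certificates, which become convex in suitable variables.
    They are built over the complex numbers, where Schur triangularization allows induction on the
    dimension, and the entrywise real part of a certificate then serves a real matrix. The same
    induction, run with output injection, turns detectability into a stabilizing gain without pole
    placement. The matrix [P] is a block of the inverse certificate and may be singular for a given
    one; strict inequalities survive a small perturbation, which makes it invertible. In the
    converse direction the empty set is vacuously path-connected, so a full-order stabilizing
    controller must be exhibited first: it is the observer-based one, and controllability of
    [(A, B)] and observability of [(C, A)] enter there. *)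

Lemma unitmx_of_ker0 (F : fieldType) n (M : 'M[F]_n) :
  (forall x : 'cV_n, M *m x = 0 -> x = 0) -> M \in unitmx.
Proof.
move=> kM; rewrite -unitmx_tr -row_free_unit -kermx_eq0; apply/rowV0P => v.
move=> /sub_kermxP vM; apply: trmx_inj; rewrite trmx0; apply: kM.
by rewrite -(trmxK M) -trmx_mul vM trmx0.
Qed.

Lemma invmxM (F : comUnitRingType) n (P S : 'M[F]_n) :
  P \in unitmx -> S \in unitmx -> invmx (P *m S) = invmx S *m invmx P.
Proof.
move=> uP uS; have uPS : P *m S \in unitmx by rewrite unitmx_mul uP.
apply: (can_inj (mulKmx uPS)).
by rewrite mulmxV // -mulmxA mulKVmx // mulmxV.
Qed.

(** * Complex Lyapunov inequalities *)

Section Hermitian.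
Variable C : numClosedFieldType.
Local Open Scope sesquilinear_scope.

Lemma adjmxM m n p (A : 'M[C]_(m, n)) (B : 'M[C]_(n, p)) :
  (A *m B)^t* = B^t* *m A^t*.
Proof. by rewrite trmx_mul map_mxM. Qed.

Lemma adjmxD m n (A B : 'M[C]_(m, n)) : (A + B)^t* = A^t* + B^t*.
Proof. by rewrite linearD /= map_mxD. Qed.

Lemma adjmxN m n (A : 'M[C]_(m, n)) : (- A)^t* = - A^t*.
Proof. by rewrite linearN /= map_mxN. Qed.

Lemma adjmxZ m n (a : C) (A : 'M[C]_(m, n)) : (a *: A)^t* = a^* *: A^t*.
Proof. by rewrite linearZ /= map_mxZ. Qed.

Lemma adjmx0 m n : (0 : 'M[C]_(m, n))^t* = 0.
Proof. by rewrite linear0 map_mx0. Qed.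

Lemma adjmx_scalar n (a : C) : (a%:M : 'M[C]_n)^t* = (a^*)%:M.
Proof. by rewrite tr_scalar_mx map_scalar_mx. Qed.

Lemma adjmx_block m1 m2 n1 n2 (A : 'M[C]_(m1, n1)) (B : 'M[C]_(m1, n2))
    (D : 'M[C]_(m2, n1)) (E : 'M[C]_(m2, n2)) :
  (block_mx A B D E)^t* = block_mx (A^t*) (D^t*) (B^t*) (E^t*).
Proof. by rewrite tr_block_mx map_block_mx. Qed.

Definition hposdef n (H : 'M[C]_n) :=
  H^t* = H /\ forall x : 'cV_n, x != 0 -> 0 < (x^t* *m H *m x) 0 0.

Definition hlyap n (P M : 'M[C]_n) :=
  hposdef P /\ hposdef (- (P *m M) - (P *m M)^t*).

Lemma hposdef_ge0 n (H : 'M[C]_n) (x : 'cV_n) :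
  hposdef H -> 0 <= (x^t* *m H *m x) 0 0.
Proof.
move=> [_ Hp]; have [->|/Hp/ltW //] := eqVneq x 0.
by rewrite mulmx0 mxE.
Qed.

Lemma hposdef_unit n (H : 'M[C]_n) : hposdef H -> H \in unitmx.
Proof.
move=> [_ Hp]; apply: unitmx_of_ker0 => x Hx; apply/eqP/negPn/negP => /Hp.
by rewrite -mulmxA Hx mulmx0 mxE ltxx.
Qed.

Lemma hposdef_congr n (H S : 'M[C]_n) :
  S \in unitmx -> hposdef H -> hposdef (S^t* *m H *m S).
Proof.
move=> uS [hH Hp]; split; first by rewrite !adjmxM trmxCK hH mulmxA.
move=> x x0; rewrite !mulmxA -adjmxM -mulmxA; apply: Hp.
by apply: contra x0 => /eqP Sx; rewrite -(mulKmx uS x) Sx mulmx0.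
Qed.

Lemma hposdef_scalar1 (a : C) : 0 < a -> hposdef (a%:M : 'M[C]_1).
Proof.
move=> a0; split; first by rewrite adjmx_scalar conj_Creal // gtr0_real.
move=> x x0; rewrite mul_mx_scalar -scalemxAl mxE mulr_gt0 //.
rewrite mxE big_ord1 !mxE mulrC mul_conjC_gt0.
by apply: contra x0 => /eqP x0; apply/eqP/matrixP => i j; rewrite !ord1 x0 mxE.
Qed.

Lemma hposdef_diag n1 n2 (H1 : 'M[C]_n1) (H2 : 'M[C]_n2) :
  hposdef H1 -> hposdef H2 -> hposdef (block_mx H1 0 0 H2).
Proof.
move=> [h1 p1] [h2 p2]; split; first by rewrite adjmx_block !adjmx0 h1 h2.
move=> x; rewrite -(vsubmxK x); move: (usubmx x) (dsubmx x) => x1 x2.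
rewrite col_mx_eq0 negb_and.
rewrite tr_col_mx map_row_mx mul_row_block mul_row_col !mulmx0 addr0 add0r mxE.
have g1 := hposdef_ge0 x1 (conj h1 p1).
have g2 := hposdef_ge0 x2 (conj h2 p2).
by move=> /orP[/p1 ?|/p2 ?]; [apply: ltr_wpDr|apply: ltr_wpDl].
Qed.

Lemma hposdef_invC n (H : 'M[C]_n) : hposdef H -> (invmx H)^t* = invmx H.
Proof.
move=> hH; have uH := hposdef_unit hH; have [hh _] := hH.
rewrite -[LHS]mulmx1 -(mulmxV uH) mulmxA -{2}hh -adjmxM mulmxV //.
by rewrite adjmx_scalar conjC1 mul1mx.
Qed.

Lemma hposdef_inv_ge0 n (H : 'M[C]_n) (u : 'rV_n) :
  hposdef H -> 0 <= (u *m invmx H *m u^t*) 0 0.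
Proof.
move=> hH; have uH := hposdef_unit hH.
have := hposdef_ge0 (invmx H *m u^t*) hH.
rewrite adjmxM trmxCK -!mulmxA (mulKVmx uH) !mulmxA.
by rewrite hposdef_invC.
Qed.

(** Schur complement: the shear [S] performs the block elimination and leaves a block diagonal
    form. *)
Lemma hposdef_schur n (H : 'M[C]_n) (a : C) (u : 'rV_n) :
  hposdef H -> (u *m invmx H *m u^t*) 0 0 < a ->
  hposdef (block_mx a%:M u (u^t*) H).
Proof.
move=> hH ua; have uH := hposdef_unit hH; have hV := hposdef_invC hH.
pose S : 'M[C]_(1 + n) := block_mx 1%:M 0 (invmx H *m u^t*) 1%:M.
have uS : S \in unitmx by rewrite unitmxE det_lblock !det1 mulr1 unitr1.
have -> : block_mx a%:M u (u^t*) H =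
    S^t* *m block_mx (a - (u *m invmx H *m u^t*) 0 0)%:M 0 0 H *m S.
  rewrite /S adjmx_block !adjmx_scalar conjC1 adjmx0 adjmxM trmxCK hV.
  rewrite !mulmx_block.
  rewrite !(mul1mx, mulmx1, mul0mx, mulmx0, addr0, add0r) mulmxKV //.
  rewrite mulKVmx // !mulmxA; congr (block_mx _ _ _ _).
  rewrite raddfB /= -[X in X = _](subrK (u *m invmx H *m u^t*)).
  by rewrite -mx11_scalar.
apply: (hposdef_congr uS); apply: hposdef_diag => //.
by apply: hposdef_scalar1; rewrite subr_gt0.
Qed.

(** [P] transforms as a form and [M] as an endomorphism, so [P *m M] transforms as a form. *)
Lemma hlyap_congr n (P M S : 'M[C]_n) : S \in unitmx ->
  hlyap P M -> hlyap (S^t* *m P *m S) (invmx S *m M *m S).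
Proof.
move=> uS [hP hN]; split; first exact: hposdef_congr.
have := hposdef_congr uS hN; congr hposdef.
rewrite !mulmxA (mulmxK uS) !adjmxM trmxCK mulmxBr mulmxN.
by rewrite mulmxBl mulNmx !mulmxA.
Qed.

Lemma hlyap_block n (r a : C) (d : 'rV_n) (c : 'cV_n) (P M : 'M[C]_n) :
  let N := - (P *m M) - (P *m M)^t* in
  let u := - (r *: d + c^t* *m P) in
  0 < r -> hlyap P M -> (u *m invmx N *m u^t*) 0 0 < r * - (a + a^*) ->
  hlyap (block_mx r%:M 0 0 P) (block_mx a%:M d c M).
Proof.
move=> N u r0 [hP hN] ua; split.
  by apply: hposdef_diag => //; apply: hposdef_scalar1.
have := hposdef_schur hN ua; congr hposdef.
have rr : r^* = r by rewrite conj_Creal // gtr0_real.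
rewrite mulmx_block !(mul0mx, addr0, add0r) -scalar_mxM mul_scalar_mx.
rewrite adjmx_block !opp_block_mx add_block_mx adjmx_scalar adjmxZ adjmxM hP.1.
congr (block_mx _ _ _ _).
- rewrite -!raddfN -raddfD /=; congr _%:M.
  by rewrite rmorphN rmorphM /= rr -mulrN -mulrN -mulrDr opprD.
- by rewrite /u opprD adjmxM hP.1.
- by rewrite /u adjmxN adjmxD adjmxZ rr adjmxM trmxCK hP.1 opprD addrC.
Qed.

(** With [d = 0] the row [u] does not depend on the weight [r], so a large [r] works; the one taken
    makes the corner equal to [k + 1]. *)
Lemma hlyap_lower n (a : C) (c : 'cV_n) (P M : 'M[C]_n) :
  hlyap P M -> a + a^* < 0 ->
  exists P', hlyap P' (block_mx a%:M 0 c M : 'M[C]_(1 + n)).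
Proof.
move=> hP a0; pose N := - (P *m M) - (P *m M)^t*.
pose u := - (c^t* *m P); pose k := (u *m invmx N *m u^t*) 0 0.
have k0 : 0 <= k by apply: hposdef_inv_ge0 hP.2.
have b0 : 0 < - (a + a^*) by rewrite oppr_gt0.
exists (block_mx ((k + 1) / - (a + a^*))%:M 0 0 P); apply: hlyap_block => //.
  by rewrite divr_gt0 // ltr_wpDl.
by rewrite scaler0 add0r -/N -/u -/k divfK ?gt_eqF // ltrDl.
Qed.

Lemma hlyap_upper n (a : C) (d : 'rV_n) (P M : 'M[C]_n) :
  hlyap P M -> a + a^* < 0 ->
  exists P', hlyap P' (block_mx a%:M d 0 M : 'M[C]_(1 + n)).
Proof.
move=> hP a0; pose N := - (P *m M) - (P *m M)^t*.
pose k := (d *m invmx N *m d^t*) 0 0.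
have k0 : 0 <= k by apply: hposdef_inv_ge0 hP.2.
have b0 : 0 < - (a + a^*) by rewrite oppr_gt0.
have k1 : 0 < k + 1 by rewrite ltr_wpDl.
pose r := - (a + a^*) / (k + 1).
have r0 : 0 < r by rewrite divr_gt0.
exists (block_mx r%:M 0 0 P); apply: hlyap_block => //.
rewrite adjmx0 mul0mx addr0 -/N -scaleNr adjmxZ -!scalemxAl -scalemxAr scalerA.
rewrite mxE -/k rmorphN /= mulrNN conj_Creal ?gtr0_real // -mulrA.
rewrite ltr_pM2l // -subr_gt0 (_ : _ - _ = r); first by [].
by rewrite -[X in X - _](divfK (lt0r_neq0 k1)) -/r mulrDr mulr1 addrAC subrr add0r.
Qed.

End Hermitian.

(** * Detectability and output injection *)

Section Detect.
Variable C : numClosedFieldType.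
Local Open Scope sesquilinear_scope.

(** Hautus test: every eigenvector invisible in the output belongs to an eigenvalue of negative real
    part, expressed as [a + a^* < 0]. *)
Definition detectable n p (A : 'M[C]_n) (D : 'M[C]_(p, n)) :=
  forall a (x : 'cV_n), x != 0 -> A *m x = a *: x -> D *m x = 0 -> a + a^* < 0.

Lemma hlyap_ker0 n (P M : 'M[C]_n) a : hlyap P M -> ~~ (a + a^* < 0) ->
  M - a%:M \in unitmx.
Proof.
move=> [hP [_ pN]] a0; apply: unitmx_of_ker0 => x.
rewrite mulmxBl mul_scalar_mx => /subr0_eq Mx.
apply/eqP; apply: contraNT a0 => x0; have := pN _ x0.
have -> : x^t* *m (- (P *m M) - (P *m M)^t*) *m x =
    - (a + a^*) *: (x^t* *m P *m x).
  rewrite mulmxBr mulmxBl mulmxN mulNmx adjmxM hP.1 -opprD.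
  rewrite scaleNr scalerDl; congr (- (_ + _)).
    by rewrite -!mulmxA Mx -!scalemxAr.
  by rewrite mulmxA -adjmxM Mx adjmxZ -!scalemxAl.
rewrite mxE mulNr oppr_gt0.
by rewrite (pmulr_llt0 _ (hP.2 _ x0)).
Qed.

Lemma hlyap_detect_congr n p (A S : 'M[C]_n) (D : 'M[C]_(p, n)) : S \in unitmx ->
  (exists P L, hlyap P (invmx S *m A *m S + L *m (D *m S))) ->
  exists P L, hlyap P (A + L *m D).
Proof.
move=> uS [P [L /(hlyap_congr (S := invmx S))]]; rewrite unitmx_inv => /(_ uS).
rewrite invmxK mulmxDr mulmxDl !mulmxA mulmxK // mulmxV // mul1mx mulmxK //.
by move=> hP; do 2![eexists]; exact: hP.
Qed.

Lemma detectable_congr n p (A S : 'M[C]_n) (D : 'M[C]_(p, n)) : S \in unitmx ->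
  detectable A D -> detectable (invmx S *m A *m S) (D *m S).
Proof.
move=> uS dA a x x0 Ax Dx; apply: (dA a (S *m x)).
- by apply: contra x0 => /eqP Sx; rewrite -(mulKmx uS x) Sx mulmx0.
- by rewrite scalemxAr -Ax !mulmxA mulmxV // mul1mx.
- by rewrite mulmxA.
Qed.

(* Peel off the first coordinate of a lower triangular matrix with diagonal
   entry [a]: the remaining block is handled by induction.  If [Re a >= 0], a
   shear decouples [a], which can then be moved to [-1] because it is visible
   in the output. *)
Lemma hlyap_detect_trig n (A : 'M[C]_n) : is_trig_mx A ->
  forall p (D : 'M[C]_(p, n)), detectable A D -> exists P L, hlyap P (A + L *m D).
Proof.
elim/trigsqmx_ind => {n A} [p D _|n a c A _ IH p D].
  by exists 0, 0; split; split=> [|x]; rewrite ?thinmx0 // flatmx0 eqxx.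
rewrite [a]mx11_scalar -(hsubmxK D); move: (a 0 0) (lsubmx D) (rsubmx D) => {}a g {}D.
move=> dA; have [|P [L hP]] := IH _ D.
  move=> b x x0 Ax Dx; apply: (dA b (col_mx 0 x)).
  - by rewrite col_mx_eq0 negb_and x0 orbT.
  - by rewrite mul_block_col !mulmx0 mul0mx !add0r Ax scale_col_mx scaler0.
  - by rewrite mul_row_col mulmx0 add0r.
have [a0|a0] := boolP (a + a^* < 0).
  have [P' hP'] := hlyap_lower (c + L *m g) hP a0.
  exists P', (col_mx 0 L); rewrite mul_col_row !mul0mx add_block_mx !addr0.
  exact: hP'.
have uM := hlyap_ker0 hP a0.
(* Chosen so that [col_mx 1 w] is an eigenvector for [a] of the system with injection [col_mx 0 L];
   the shear [S] below moves it to the first basis vector. *)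
pose w := - invmx (A + L *m D - a%:M) *m (c + L *m g).
have Ew : c + L *m g + (A + L *m D) *m w = a *: w.
  apply/eqP; rewrite -subr_eq0 -addrA -mul_scalar_mx -mulmxBl /w mulmxA mulmxN.
  by rewrite mulmxV // mulNmx mul1mx subrr.
clearbody w.
(* If the output vanished on [col_mx 1 w], the injection would not act on it, and it would be an
   invisible eigenvector of the original matrix. *)
have g0 : g + D *m w != 0.
  apply: contraNneq a0 => gw; apply: (dA a (col_mx 1%:M w)).
  - by rewrite col_mx_eq0 negb_and matrix_nonzero1.
  - rewrite mul_block_col mul0mx !mulmx1 addr0 scale_col_mx scalemx1.
    congr col_mx; rewrite -Ew mulmxDl addrACA -!mulmxA -mulmxDr gw mulmx0.
    by rewrite addr0.
  - by rewrite mul_row_col mulmx1.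
have [l lg] : exists l : 'rV_p, l *m (g + D *m w) = 1%:M.
  move: (g + D *m w) g0 => y /cV0Pn[i yi]; exists ((y i 0)^-1 *: delta_mx 0 i).
  rewrite -scalemxAl -rowE [row _ _]mx11_scalar mxE -scalemx1 scalerA.
  by rewrite mulVf // scale1r.
pose S : 'M[C]_(1 + n) := block_mx 1%:M 0 w 1%:M.
have uS : S \in unitmx by rewrite unitmxE det_lblock !det1 mulr1 unitr1.
have N1 : -1 + (-1 : C)^* < 0.
  by rewrite rmorphN rmorph1 -opprD oppr_lt0 addr_gt0.
have [P' hP'] := hlyap_upper ((- 1 - a) *: (l *m D)) hP N1.
apply: (hlyap_detect_congr uS).
(* Since [l] reads 1 on the first basis vector, this gain moves [a] to [-1]; it spoils only the
   upper row, which [hlyap_upper] tolerates. *)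
exists P', (col_mx ((- 1 - a) *: l) L).
have -> : invmx S *m block_mx a%:M 0 c A *m S = block_mx a%:M 0 (c + A *m w - a *: w) A.
  rewrite -mulmxA; apply: (canLR (mulKmx uS)).
  rewrite /S !mulmx_block !(mul1mx, mulmx1, mul0mx, mulmx0, addr0, add0r).
  by rewrite mul_mx_scalar [_ *: _ + _]addrC subrK.
rewrite mul_row_block !mulmx1 mulmx0 add0r mul_col_row add_block_mx add0r.
rewrite -!scalemxAl lg scalemx1 -raddfD /= addrC subrK mulmxDr !mulmxA.
suff -> : c + A *m w - a *: w + (L *m g + L *m D *m w) = 0 by [].
by apply/eqP; rewrite addrAC subr_eq0 -Ew mulmxDl addrACA.
Qed.

Lemma hlyap_detect n p (A : 'M[C]_n) (D : 'M[C]_(p, n)) :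
  detectable A D -> exists P L, hlyap P (A + L *m D).
Proof.
case: n => [|n] in A D *.
  move=> _; exists 0, 0.
  by split; split=> [|x]; rewrite ?thinmx0 // flatmx0 eqxx.
move=> dA; have [|S unS] := @Schur C n.+1 A; first by [].
have uS := unitarymx_unit unS.
rewrite /similar_to /= conjumx // => tA.
have uS' : invmx S \in unitmx by rewrite unitmx_inv.
apply: (hlyap_detect_congr uS'); rewrite invmxK.
apply: hlyap_detect_trig => //.
by have := detectable_congr uS' dA; rewrite invmxK.
Qed.

End Detect.

(** * Real Lyapunov inequalities *)

Section RealForms.
Variable R : realType.
Local Notation C := (complex R).
Local Notation rc := (real_complex R).
Local Notation Re := (@complex.Re R).
Local Notation Im := (@complex.Im R).
Local Open Scope sesquilinear_scope.

Lemma ReD (x y : C) : Re (x + y) = Re x + Re y.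
Proof. by case: x y => [a b] [c d]. Qed.

Lemma ReM_real (x : C) (r : R) : Re (x * rc r) = Re x * r.
Proof. by case: x => a b /=; rewrite mulr0 subr0. Qed.

Lemma ImD (x y : C) : Im (x + y) = Im x + Im y.
Proof. by case: x y => [a b] [c d]. Qed.

Lemma ImM_real (x : C) (r : R) : Im (x * rc r) = Im x * r.
Proof. by case: x => a b /=; rewrite mulr0 add0r. Qed.

Lemma Re_conj (x : C) : Re (x^*) = Re x.
Proof. by case: x. Qed.

Lemma addC_conj_lt0 (a : C) : (a + a^* < 0) = (Re a < 0).
Proof.
rewrite ltcE /= ReD Re_conj -mulr2n pmulrn_llt0 //.
by case: a => x y /=; rewrite subrr eqxx.
Qed.

Lemma map_Re_mulmx m n p (A : 'M[C]_(m, n)) (B : 'M[R]_(n, p)) :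
  map_mx Re (A *m map_mx rc B) = map_mx Re A *m B.
Proof.
apply/matrixP => i j; rewrite !mxE (big_morph _ ReD (erefl _)).
by apply: eq_bigr => k _; rewrite !mxE ReM_real.
Qed.

Lemma map_Re_mulmxl m n p (A : 'M[R]_(m, n)) (B : 'M[C]_(n, p)) :
  map_mx Re (map_mx rc A *m B) = A *m map_mx Re B.
Proof.
apply/matrixP => i j; rewrite !mxE (big_morph _ ReD (erefl _)).
by apply: eq_bigr => k _; rewrite !mxE mulrC ReM_real mulrC.
Qed.

Lemma map_Im_mulmxl m n p (A : 'M[R]_(m, n)) (B : 'M[C]_(n, p)) :
  map_mx Im (map_mx rc A *m B) = A *m map_mx Im B.
Proof.
apply/matrixP => i j; rewrite !mxE (big_morph _ ImD (erefl _)).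
by apply: eq_bigr => k _; rewrite !mxE mulrC ImM_real mulrC.
Qed.

(* [M] is not assumed symmetric: only its symmetric part matters. *)
Definition posform n (M : 'M[R]_n) :=
  forall x : 'cV_n, x != 0 -> 0 < (x^T *m M *m x) 0 0.

Definition lyap n (P M : 'M[R]_n) := posdef P /\ posform (- (P *m M)).

Lemma map_mx_rc_eq0 m n (x : 'M[R]_(m, n)) : (map_mx rc x == 0) = (x == 0).
Proof. by rewrite -(map_mx0 rc); apply/eqP/eqP => [/map_mx_inj|->]. Qed.

(** On a real vector the form of [Re H] is the real part of that of [H], and a positive complex
    number has positive real part. *)
Lemma hform_pos_Re n (H : 'M[C]_n) :
  (forall x : 'cV_n, x != 0 -> 0 < (x^t* *m H *m x) 0 0) -> posform (map_mx Re H).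
Proof.
move=> hH x x0; have := hH (map_mx rc x); rewrite map_mx_rc_eq0 => /(_ x0).
have -> : (map_mx rc x)^t* = map_mx rc x^T.
  by apply/matrixP => i j; rewrite !mxE [LHS]conjc_real.
by rewrite ltcE => /andP[_]; rewrite -map_Re_mulmxl -map_Re_mulmx [X in _ -> _ < X]mxE.
Qed.

Lemma trmx_map_Re n (H : 'M[C]_n) : (map_mx Re H)^T = map_mx Re (H^t*).
Proof. by apply/matrixP => i j; rewrite !mxE Re_conj. Qed.

Lemma hposdef_Re n (H : 'M[C]_n) : hposdef H -> posdef (map_mx Re H).
Proof. by move=> [hH pH]; split; [rewrite trmx_map_Re hH|apply: hform_pos_Re]. Qed.

Lemma map_Re_herm n (N : 'M[C]_n) :
  map_mx Re (- N - N^t*) = - map_mx Re N - (map_mx Re N)^T.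
Proof.
have ReN (x : C) : Re (- x) = - Re x by case: x.
by apply/matrixP => i j; rewrite trmx_map_Re !mxE ReD !ReN.
Qed.

Lemma map_ReD m n (A B : 'M[C]_(m, n)) :
  map_mx Re (A + B) = map_mx Re A + map_mx Re B.
Proof. by apply/matrixP => i j; rewrite !mxE ReD. Qed.

Lemma posform_unit n (M : 'M[R]_n) : posform M -> M \in unitmx.
Proof.
move=> pM; apply: unitmx_of_ker0 => x Mx; apply/eqP/negPn/negP => /pM.
by rewrite -mulmxA Mx mulmx0 mxE ltxx.
Qed.

Lemma quad_tr n (M : 'M[R]_n) (x : 'cV_n) :
  (x^T *m M^T *m x) 0 0 = (x^T *m M *m x) 0 0.
Proof.
have -> : x^T *m M^T *m x = (x^T *m M *m x)^T by rewrite !trmx_mul trmxK mulmxA.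
by rewrite [LHS]mxE.
Qed.

(** The complex gain [L] has no reason to be real. As [A] and [D] are real, taking real parts of
    [P A + P L D] shows that [Re P] with the gain [(Re P)^-1 Re (P L)] works. *)
Lemma lyap_detect n p (A : 'M[R]_n) (D : 'M[R]_(p, n)) :
  (forall (a : C) (x : 'cV_n), x != 0 -> map_mx rc A *m x = a *: x ->
     map_mx rc D *m x = 0 -> Re a < 0) ->
  exists P L, lyap P (A + L *m D).
Proof.
move=> dA; have [|P [L [hP hN]]] := @hlyap_detect _ _ _ (map_mx rc A) (map_mx rc D).
  by move=> a x x0 Ax Dx; rewrite addC_conj_lt0; apply: dA Ax Dx.
have pP := hposdef_Re hP; have uP := posform_unit pP.2.
exists (map_mx Re P), (invmx (map_mx Re P) *m map_mx Re (P *m L)); split=> // x x0.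
rewrite mulmxDr !mulmxA mulmxV // mul1mx -!map_Re_mulmx.
have := hform_pos_Re hN.2 x0.
set N := P *m _; have -> : map_mx Re (P *m map_mx rc A) +
    map_mx Re (P *m L *m map_mx rc D) = map_mx Re N.
  by rewrite /N mulmxDr mulmxA map_ReD.
rewrite map_Re_herm; have -> : - (map_mx Re N)^T = (- map_mx Re N)^T by rewrite linearN.
by rewrite mulmxDr mulmxDl mxE quad_tr -mulr2n pmulrn_lgt0.
Qed.

(** [eigenvalue] speaks of row eigenvectors; transposition preserves the spectrum. *)
Lemma stable_colP n (M : 'M[R]_n) :
  stable M <-> forall (a : C) (x : 'cV_n), x != 0 ->
    map_mx rc M *m x = a *: x -> Re a < 0.
Proof.
have E a : eigenvalue (map_mx rc M) a = eigenvalue (map_mx rc M)^T a.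
  have F (B : 'M[C]_n) : eigenvalue B a = (B - a%:M \notin unitmx).
    by rewrite /eigenvalue /eigenspace kermx_eq0 row_free_unit.
  by rewrite !F -unitmx_tr linearB /= tr_scalar_mx.
split=> [sM a x x0 Mx|sM a].
  apply: sM; rewrite E; apply/eigenvalueP; exists x^T; last by rewrite trmx_eq0.
  by rewrite -trmx_mul Mx linearZ.
rewrite E => /eigenvalueP[v vM v0]; apply: (sM a v^T); first by rewrite trmx_eq0.
by rewrite -[map_mx _ _]trmxK -trmx_mul vM linearZ.
Qed.

Lemma stable_lyap n (M : 'M[R]_n) : stable M -> exists P, lyap P M.
Proof.
(* With no output at all, detectability is stability. *)
move=> /stable_colP sM; have [|P [L]] := @lyap_detect n 0 M 0.
  by move=> a x x0 Mx _; apply: sM x0 Mx.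
by rewrite mulmx0 addr0 => ?; exists P.
Qed.

(** For an eigenvector [u + i v], summing the forms of [P M] at [u] and at [v] cancels the terms in
    [Im a], by symmetry of [P], and leaves [Re a] times a positive number. *)
Lemma lyap_stable n (P M : 'M[R]_n) : lyap P M -> stable M.
Proof.
move=> [[sP pP] pN]; apply/stable_colP => a x x0 Mx.
pose u := map_mx Re x; pose v := map_mx Im x.
have xE : (u != 0) || (v != 0).
  apply: contraNT x0; rewrite negb_or !negbK => /andP[/eqP u0 /eqP v0].
  apply/eqP/matrixP => i j; rewrite mxE; apply/eqP; rewrite eq_complex /=.
  have /matrixP/(_ i j) := u0; have /matrixP/(_ i j) := v0.
  by rewrite !mxE => -> ->; rewrite eqxx.
have Mu : M *m u = Re a *: u - Im a *: v.
  rewrite -map_Re_mulmxl Mx; apply/matrixP => i j; rewrite !mxE.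
  by case: (a) (x i j) => [? ?] [? ?].
have Mv : M *m v = Re a *: v + Im a *: u.
  rewrite -map_Im_mulmxl Mx; apply/matrixP => i j; rewrite !mxE.
  by case: (a) (x i j) => [? ?] [? ?].
have ge (N : 'M[R]_n) (y : 'cV_n) : posform N -> 0 <= (y^T *m N *m y) 0 0.
  move=> pM; have [->|y0] := eqVneq y 0; last by rewrite ltW ?pM.
  by rewrite mulmx0 mxE.
have gt (N : 'M[R]_n) : posform N -> 0 < (u^T *m N *m u) 0 0 + (v^T *m N *m v) 0 0.
  move=> pM; by case/orP: xE => /pM ?; [rewrite ltr_wpDr ?ge|rewrite ltr_wpDl ?ge].
have uv : (u^T *m (P *m v)) 0 0 = (v^T *m (P *m u)) 0 0.
  have -> : u^T *m (P *m v) = (v^T *m (P *m u))^T.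
    by rewrite !trmx_mul sP trmxK mulmxA.
  by rewrite mxE.
have lin (y : 'rV_n) (w z : 'cV_n) (b c : R) : (y *m (P *m (b *: w + c *: z))) 0 0 =
    b * (y *m (P *m w)) 0 0 + c * (y *m (P *m z)) 0 0.
  rewrite !mulmxDr -!scalemxAr; move: (y *m _) (y *m _) => k l.
  by rewrite !mxE.
have := gt _ pN; rewrite !mulmxN !mulNmx -!mulmxA Mu Mv -scaleNr.
rewrite [X in X + _]mxE [X in _ + X]mxE !lin.
have := gt _ pP; rewrite -!mulmxA uv.
move: ((u^T *m _) 0 0) ((v^T *m _) 0 0) ((v^T *m _) 0 0) => p q r p0.
rewrite (_ : _ + _ = - Re a * (p + r)); last by ring.
by rewrite mulNr oppr_gt0 pmulr_llt0.
Qed.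

End RealForms.

(** * Quantitative positivity and its stability under perturbation *)

Section Perturb.
Variable R : realType.

Lemma normsq_gt0 n (x : 'cV[R]_n) : x != 0 -> 0 < (x^T *m x) 0 0.
Proof.
case/cV0Pn => i xi; rewrite mxE (bigD1 i) //= mxE -expr2 ltr_pwDl //.
  by rewrite exprn_even_gt0.
by apply: sumr_ge0 => j _; rewrite mxE -expr2 sqr_ge0.
Qed.

Lemma normsq_ge0 n (x : 'cV[R]_n) : 0 <= (x^T *m x) 0 0.
Proof.
by have [->|/normsq_gt0/ltW//] := eqVneq x 0; rewrite mulmx0 mxE.
Qed.

Lemma quad_block n1 n2 (A : 'M[R]_n1) b c (D : 'M[R]_n2) (u : 'cV_n1) (y : 'cV_n2) :
  ((col_mx u y)^T *m block_mx A b c D *m col_mx u y) 0 0 =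
  (u^T *m A *m u) 0 0 + (u^T *m b *m y) 0 0 + (y^T *m c *m u) 0 0 +
  (y^T *m D *m y) 0 0.
Proof.
rewrite tr_col_mx mul_row_block mul_row_col !mulmxDl.
move: (u^T *m A *m u) (u^T *m b *m y) (y^T *m c *m u) (y^T *m D *m y) => k l o q.
by rewrite !mxE addrACA !addrA.
Qed.

Lemma normsq_col n1 n2 (u : 'cV[R]_n1) (y : 'cV[R]_n2) :
  ((col_mx u y)^T *m col_mx u y) 0 0 = (u^T *m u) 0 0 + (y^T *m y) 0 0.
Proof. by rewrite tr_col_mx mul_row_col mxE. Qed.

Lemma quad_upper n (E : 'M[R]_n) :
  exists2 K : R, 0 < K & forall x : 'cV_n, (x^T *m E *m x) 0 0 <= K * (x^T *m x) 0 0.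
Proof.
(* The sum suffices for the bound; the 1 keeps [K] positive, as it later appears in denominators. *)
exists (1 + \sum_i \sum_j `|E i j|) => [|x].
  by rewrite ltr_pwDl // sumr_ge0 // => i _; rewrite sumr_ge0.
have xk k : x k 0 ^+ 2 <= (x^T *m x) 0 0.
  rewrite mxE (bigD1 k) //= mxE -expr2 lerDl.
  by apply: sumr_ge0 => j _; rewrite mxE -expr2 sqr_ge0.
rewrite mulrDl mul1r; apply: ler_wpDl; first exact: normsq_ge0.
rewrite -mulmxA mxE mulr_suml; apply: ler_sum => i _.
rewrite mxE mxE mulr_sumr mulr_suml; apply: ler_sum => j _.
have := xk i; have := xk j; move: (x i 0) (x j 0) (_ 0 0) (E i j) => a b q e bq aq.
have abq : `|a * b| <= q.
  rewrite normrM; have := sqr_ge0 (`|a| - `|b|).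
  rewrite sqrrB !real_normK ?num_real //; lra.
apply: le_trans (ler_norm _) _; rewrite mulrCA normrM.
exact: ler_wpM2l.
Qed.

(** Completing the square in the first coordinate gives an induction on the dimension, in place of
    compactness of the sphere. Since [M] need not be symmetric, [w] averages [b] and [c^T]. *)
Lemma posform_lower n (M : 'M[R]_n) : posform M ->
  exists2 d : R, 0 < d & forall x : 'cV_n, d * (x^T *m x) 0 0 <= (x^T *m M *m x) 0 0.
Proof.
elim: n M => [|n IH] M pM.
  by exists 1 => // x; rewrite !mul1r [x]flatmx0 !mulmx0.
move: M pM; change n.+1 with (1 + n)%N => M.
rewrite -(submxK M) [ulsubmx M]mx11_scalar.
move: (ulsubmx M 0 0) (ursubmx M) (dlsubmx M) (drsubmx M) => a b c D pM.
have a0 : 0 < a.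
  have := pM (col_mx 1%:M 0); rewrite col_mx_eq0 negb_and matrix_nonzero1 => /(_ isT).
  rewrite tr_col_mx mul_row_block mul_row_col trmx0 !mul0mx !mulmx0 !addr0.
  by rewrite trmx1 mulmx1 mul1mx mxE mulr1n.
pose w := (2 * a)^-1 *: (b + c^T).
have wE (y : 'cV_n) : (w *m y) 0 0 = (2 * a)^-1 * ((b *m y) 0 0 + (c^T *m y) 0 0).
  by rewrite -scalemxAl mulmxDl [LHS]mxE; congr (_ * _); rewrite mxE.
clearbody w.
have formE (t : R) y : ((col_mx t%:M y)^T *m block_mx a%:M b c D *m col_mx t%:M y) 0 0 =
    a * (t + (w *m y) 0 0) ^+ 2 + (y^T *m (D - a *: (w^T *m w)) *m y) 0 0.
  rewrite quad_block tr_scalar_mx !mul_mx_scalar !mul_scalar_mx -!scalemxAl.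
  rewrite mulmxBr mulmxBl -scalemxAr -scalemxAl.
  have -> : y^T *m (w^T *m w) *m y = (w *m y)^T *m (w *m y).
    by rewrite trmx_mul !mulmxA.
  have -> : y^T *m c = (c^T *m y)^T by rewrite trmx_mul trmxK.
  have := wE y; rewrite [w *m y]mx11_scalar [c^T *m y]mx11_scalar [b *m y]mx11_scalar.
  move: (y^T *m D *m y) ((w *m y) 0 0) ((b *m y) 0 0) ((c^T *m y) 0 0) => N v p q.
  rewrite !tr_scalar_mx -!scalar_mxM !mxE !mulr1n => ->.
  by field; rewrite gt_eqF.
have pD : posform (D - a *: (w^T *m w)).
  move=> y y0; have := pM (col_mx (- (w *m y) 0 0)%:M y).
  rewrite col_mx_eq0 negb_and y0 orbT => /(_ isT).
  by rewrite formE addNr expr0n mulr0 add0r.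
have [d d0 dP] := IH _ pD; have [K K0 KP] := quad_upper (w^T *m w).
(* With [v = w y], one has [t^2 <= 2 (t + v)^2 + 2 v^2] and [v^2 <= K |y|^2]: the first bound on [e]
   absorbs the square, the second the [|y|^2] terms. *)
pose e := Num.min (a / 2) (d / (1 + 2 * K)).
have K1 : 0 < 1 + 2 * K by lra.
have e0 : 0 < e by rewrite lt_min !divr_gt0.
exists e => // x; rewrite -(vsubmxK x) [usubmx x]mx11_scalar.
move: (usubmx x 0 0) (dsubmx x) => t y.
rewrite formE; have := dP y; have := KP y.
have -> : y^T *m (w^T *m w) *m y = (w *m y)^T *m (w *m y).
  by rewrite trmx_mul !mulmxA.
have -> : ((w *m y)^T *m (w *m y)) 0 0 = (w *m y) 0 0 ^+ 2.
  by rewrite [w *m y]mx11_scalar tr_scalar_mx -scalar_mxM !mxE !mulr1n expr2.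
rewrite normsq_col; have -> : ((t%:M : 'cV_1)^T *m t%:M) 0 0 = t * t.
  by rewrite tr_scalar_mx -scalar_mxM mxE mulr1n.
have := normsq_ge0 y.
move: ((y^T *m y) 0 0) ((w *m y) 0 0) ((y^T *m _ *m y) 0 0) => r v q r0 vr rq.
have ea : e <= a / 2 by rewrite ge_min lexx.
have ed : e * (1 + 2 * K) <= d by rewrite -ler_pdivlMr // ge_min lexx orbT.
have h1 : t * t <= 2 * (t + v) ^+ 2 + 2 * v ^+ 2.
  have := sqr_ge0 (t + v + v); rewrite !expr2; lra.
have h2 : e * (t * t + r) <= e * (2 * (t + v) ^+ 2 + (1 + 2 * K) * r).
  by apply: ler_wpM2l; [exact: ltW|lra].
have h3 : e * (2 * (t + v) ^+ 2) <= a * (t + v) ^+ 2.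
  by rewrite mulrA; apply: ler_wpM2r; [exact: sqr_ge0|lra].
have h4 : e * ((1 + 2 * K) * r) <= d * r by rewrite mulrA; exact: ler_wpM2r.
lra.
Qed.

Lemma posform_perturb n (M E : 'M[R]_n) : posform M ->
  exists2 d : R, 0 < d & forall e, 0 <= e <= d -> posform (M + e *: E).
Proof.
move=> /posform_lower[d d0 dP]; have [K K0 KP] := quad_upper (- E).
(* The perturbation then consumes at most half of the margin [d]. *)
exists (d / (2 * K)) => [|e /andP[e0 ed] x x0].
  by rewrite divr_gt0 // mulr_gt0.
have := dP x; have := KP x; have := normsq_gt0 x0.
have -> : (x^T *m - E *m x) 0 0 = - (x^T *m E *m x) 0 0.
  by rewrite mulmxN mulNmx; move: (x^T *m E *m x) => k; rewrite mxE.
have -> : (x^T *m (M + e *: E) *m x) 0 0 =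
    (x^T *m M *m x) 0 0 + e * (x^T *m E *m x) 0 0.
  rewrite mulmxDr mulmxDl -scalemxAr -scalemxAl.
  by move: (x^T *m M *m x) (x^T *m E *m x) => k l; rewrite !mxE.
move: (_ 0 0) (_ 0 0) (_ 0 0) => q k r r0 kr rq.
have h1 : e * (2 * K) <= d by rewrite -ler_pdivlMr // mulr_gt0.
have h2 : e * - k <= e * (K * r) by apply: ler_wpM2l.
have h3 : e * (2 * K) * r <= d * r by apply: ler_wpM2r => //; exact: ltW.
have h4 : 0 < d * r by apply: mulr_gt0.
lra.
Qed.

End Perturb.

(** * Convex parametrization of the full-order controllers *)

(** Among [size q] distinct points [d / (i + 1)], one is not a root. *)
Lemma poly_nonroot_small (R : realType) (q : {poly R}) (d : R) :
  q != 0 -> 0 < d -> exists2 e, 0 <= e <= d & ~~ root q e.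
Proof.
move=> q0 d0; pose s := [seq d / i.+1%:R | i <- iota 0 (size q)].
have us : uniq s.
  rewrite map_inj_in_uniq ?iota_uniq // => i j _ _ /(mulfI (lt0r_neq0 d0)).
  by move=> /invr_inj/eqP; rewrite eqr_nat => /eqP[].
have : ~~ all (root q) s.
  by apply/negP => /(max_poly_roots q0)/(_ us); rewrite size_map size_iota ltnn.
rewrite -has_predC => /hasP[e /mapP[i _ ->] nr]; exists (d / i.+1%:R) => //.
have d0' := ltW d0; apply/andP; split; first by rewrite divr_ge0.
by rewrite ler_pdivrMr ?ltr0n // ler_peMr // ler1n.
Qed.

Lemma unitmx_shift_small (R : realType) n (U : 'M[R]_n) (d : R) :
  0 < d -> exists2 e, 0 <= e <= d & U + e%:M \in unitmx.
Proof.
move=> d0; have q0 : char_poly (- U) != 0 by rewrite monic_neq0 ?char_poly_monic.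
have [e e0 e1] := poly_nonroot_small q0 d0; exists e => //; move: e1.
rewrite -eigenvalue_root_char /eigenvalue /eigenspace kermx_eq0.
rewrite row_free_unit negbK -opprD -scaleN1r unitmxZ //.
by rewrite unitrN unitr1.
Qed.

Section Param.
Variables (R : realType) (n m p : nat).
Variables (A : 'M[R]_n) (B : 'M[R]_(n, m)) (C : 'M[R]_(p, n)).

Lemma posform_congr k (N T : 'M[R]_k) :
  T \in unitmx -> posform N -> posform (T^T *m N *m T).
Proof.
move=> uT pN x x0; rewrite !mulmxA -trmx_mul -mulmxA; apply: pN.
by apply: contra x0 => /eqP Tx; rewrite -(mulKmx uT x) Tx mulmx0.
Qed.

Lemma posdef_congr k (N T : 'M[R]_k) :
  T \in unitmx -> posdef N -> posdef (T^T *m N *m T).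
Proof.
move=> uT [sN pN]; split; last exact: posform_congr.
by rewrite !trmx_mul trmxK sN mulmxA.
Qed.

(* The linearizing change of variables of LQG synthesis.  If [Q] certifies the
   stability of the closed loop [Acl], [Y] and [Xi] are the first block row of [Q],
   [X] and [P] the first block column of [Q^-1], and [T := [X, 1; P, 0]], then
   [lmi_gram] is [T^T Q T] and [lmi_lyap] is [T^T Q Acl T], both affine in
   [X], [Y], [F := CK P], [H := Xi BK] and the lower left block [M] of the latter.
   Conversely, [P] being free, [Xi P = 1 - Y X = coupling X Y] recovers the
   controller. *)
Definition lmi_gram (X Y : 'M[R]_n) : 'M[R]_(n + n) := block_mx X 1%:M 1%:M Y.

Definition lmi_lyap (X Y : 'M[R]_n) (F : 'M[R]_(m, n)) (H : 'M[R]_(n, p))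
    (M : 'M[R]_n) : 'M[R]_(n + n) :=
  block_mx (A *m X + B *m F) A M (Y *m A + H *m C).

Definition lmi X Y F H M :=
  posdef (lmi_gram X Y) /\ posform (- lmi_lyap X Y F H M).

Definition coupling (X Y : 'M[R]_n) : 'M[R]_n := 1%:M - Y *m X.

(** Solution for [AK] of the equation defining the block [M], in the coordinates where [P = 1] and
    hence [Xi = coupling X Y]. *)
Definition lmiA (X Y : 'M[R]_n) (F : 'M[R]_(m, n)) (H : 'M[R]_(n, p)) (M : 'M[R]_n) :=
  invmx (coupling X Y) *m (M - Y *m A *m X - H *m C *m X - Y *m B *m F).

Definition lmiB (X Y : 'M[R]_n) (H : 'M[R]_(n, p)) := invmx (coupling X Y) *m H.

Lemma lmi_coupling_unit X Y : posdef (lmi_gram X Y) -> coupling X Y \in unitmx.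
Proof.
move=> [_ pZ]; apply: unitmx_of_ker0 => v.
(* If [Y X v = v], then [(v, - X v)] is in the kernel of the Gram matrix. *)
rewrite mulmxBl mul1mx => /subr0_eq Jv; apply/eqP; apply: contraT => v0.
have := pZ (col_mx v (- (X *m v))); rewrite col_mx_eq0 negb_and v0 => /(_ isT).
rewrite -mulmxA mul_block_col !mulmxN !mul1mx !mulmxA -Jv subrr.
by rewrite subrr col_mx0 mulmx0 mxE ltxx.
Qed.

Lemma lmi_stable X Y F H M : lmi X Y F H M ->
  stable (closed_loop A B C (lmiA X Y F H M) (lmiB X Y H) F).
Proof.
move=> [pZ pN]; have uJ := lmi_coupling_unit pZ.
set K := closed_loop _ _ _ _ _ _.
(* The matrix [T] of the change of variables with [P = 1], its inverse [V], and [S], which is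
   [T^T Q] for the certificate [Q := V^T gram V]. *)
pose T : 'M[R]_(n + n) := block_mx X 1%:M 1%:M 0.
pose V : 'M[R]_(n + n) := block_mx 0 1%:M 1%:M (- X).
pose S : 'M[R]_(n + n) := block_mx 1%:M 0 Y (coupling X Y).
have TV : T *m V = 1%:M.
  rewrite mulmx_block !(mulmx0, mul0mx, mul1mx, mulmx1, addr0, add0r) subrr.
  by rewrite -scalar_mx_block.
have [uT uV] := mulmx1_unit TV.
have ST : S *m T = lmi_gram X Y.
  rewrite mulmx_block !(mulmx0, mul0mx, mul1mx, mulmx1, addr0, add0r).
  by rewrite /coupling addrC subrK.
have SKT : S *m K *m T = lmi_lyap X Y F H M.
  rewrite /S /K /closed_loop mulmx_block.
  rewrite !(mul0mx, mul1mx, addr0) /lmiA /lmiB -!mulmxA !mulKVmx // !mulmxA.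
  rewrite mulmx_block !(mulmx0, mulmx1, addr0); congr (block_mx _ _ _ _).
  rewrite mulmxDl addrAC !addrA.
  move: (Y *m A *m X) (Y *m B *m F) (H *m C *m X) => a b c.
  by apply/matrixP => i j; rewrite !mxE; ring.
apply: (@lyap_stable _ _ (V^T *m lmi_gram X Y *m V)); split.
  exact: posdef_congr.
have -> : - (V^T *m lmi_gram X Y *m V *m K) = V^T *m - lmi_lyap X Y F H M *m V.
  rewrite mulmxN mulNmx -SKT -ST; congr (- _).
  by rewrite !mulmxA -!(mulmxA _ T V) TV !mulmx1.
exact: posform_congr.
Qed.

Lemma stable_similar AK BK CK (P : 'M[R]_n) : P \in unitmx ->
  stable (closed_loop A B C AK BK CK) ->
  stable (closed_loop A B C (P *m AK *m invmx P) (P *m BK) (CK *m invmx P)).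
Proof.
move=> uP /stable_lyap[Q [pQ pN]].
set K := closed_loop _ _ _ _ _ _ in pN *; set K' := closed_loop _ _ _ _ _ _.
pose V : 'M[R]_(n + n) := block_mx 1%:M 0 0 (invmx P).
have uV : V \in unitmx.
  by rewrite unitmxE det_ublock det1 mul1r -unitmxE unitmx_inv.
have VK : V *m K' = K *m V.
  rewrite !mulmx_block !(mulmx0, mul0mx, mul1mx, mulmx1, addr0, add0r) !mulmxA.
  by rewrite mulVmx // !mul1mx.
apply: (@lyap_stable _ _ (V^T *m Q *m V)); split; first exact: posdef_congr.
have -> : - (V^T *m Q *m V *m K') = V^T *m - (Q *m K) *m V.
  by rewrite mulmxN mulNmx -[_ *m V *m K']mulmxA VK !mulmxA.
exact: posform_congr.
Qed.

Lemma stable_lmi AK BK CK : stable (closed_loop A B C AK BK CK) ->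
  exists X Y F H M (P : 'M[R]_n), [/\ lmi X Y F H M, P \in unitmx,
    AK = P *m lmiA X Y F H M *m invmx P, BK = P *m lmiB X Y H & CK = F *m invmx P].
Proof.
set K := closed_loop _ _ _ _ _ _ => /stable_lyap[Q [pQ pN]].
(* Adding [e E] to the certificate shifts its off-diagonal block by [e]; this block must be
   invertible for [P] to be so. *)
pose E : 'M[R]_(n + n) := block_mx 0 1%:M 1%:M 0.
have [d1 d10 dQ] := posform_perturb E pQ.2.
have [d2 d20 dN] := posform_perturb (- (E *m K)) pN.
have [e e0 ue] : exists2 e, 0 <= e <= Num.min d1 d2 & ursubmx Q + e%:M \in unitmx.
  by apply: unitmx_shift_small; rewrite lt_min d10.
have {e0} [e0 e1 e2] : [/\ 0 <= e, e <= d1 & e <= d2].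
  by move: e0; rewrite le_min => /and3P.
have {dQ} pQe := dQ e (introT andP (conj e0 e1)).
have {dN} pNe := dN e (introT andP (conj e0 e2)).
have : posdef (Q + e *: E).
  split=> //; rewrite linearD linearZ /= pQ.1 /E tr_block_mx !trmx0 !trmx1 //.
have {}pNe : posform (- ((Q + e *: E) *m K)).
  by rewrite mulmxDl opprD -scalemxAl -scalerN.
move: pNe; have -> : Q + e *: E =
    block_mx (ulsubmx Q) (ursubmx Q + e%:M) (ursubmx Q + e%:M)^T (drsubmx Q).
  rewrite /E scale_block_mx !scaler0 scalemx1 -[X in X + _]submxK add_block_mx.
  rewrite !addr0 linearD /= tr_scalar_mx; congr (block_mx _ _ (_ + _) _).
  by rewrite -[in LHS]pQ.1 -trmx_ursub.
move: (ulsubmx Q) (ursubmx Q + e%:M) (drsubmx Q) ue => Y Xi Yh uXi.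
move=> {Q pQ pN d1 d10 d2 d20 e pQe e0 e1 e2} => pN pQ.
set Q := block_mx _ _ _ _ in pN pQ.
have uQ := posform_unit pQ.2.
pose X := ulsubmx (invmx Q); pose P := dlsubmx (invmx Q).
have [QX QP] : Y *m X + Xi *m P = 1%:M /\ Xi^T *m X + Yh *m P = 0.
  have := mulmxV uQ; rewrite -[invmx Q]submxK mulmx_block scalar_mx_block.
  by move=> /eq_block_mx[].
(* As [Xi] is invertible, [Xi^T X + Yh P = 0] expresses [X] through [P]; substituting in
   [Y X + Xi P = 1] exhibits a left inverse of [P]. *)
have uP : P \in unitmx.
  have uXiT : Xi^T \in unitmx by rewrite unitmx_tr.
  have XE : X = - (invmx Xi^T *m Yh *m P).
    rewrite -[LHS](mulKmx uXiT) -mulmxA -mulmxN; congr (_ *m _).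
    by apply/eqP; rewrite -addr_eq0 QP.
  have : (Xi - Y *m invmx Xi^T *m Yh) *m P = 1%:M.
    by rewrite mulmxBl -QX XE mulmxN !mulmxA addrC.
  by case/mulmx1_unit.
pose T : 'M[R]_(n + n) := block_mx X 1%:M P 0.
have uT : T \in unitmx.
  have : T *m block_mx 0 (invmx P) 1%:M (- (X *m invmx P)) = 1%:M.
    rewrite mulmx_block !(mulmx0, mul0mx, mul1mx, mulmx1, addr0, add0r).
    by rewrite subrr mulmxV // -scalar_mx_block.
  by case/mulmx1_unit.
have QT : Q *m T = block_mx 1%:M Y 0 (Xi^T).
  by rewrite mulmx_block !mulmx1 !mulmx0 !addr0 QX QP.
have TQ : T^T *m Q = block_mx 1%:M 0 Y Xi.
  have sY : Y^T = Y by have := pQ.1; rewrite tr_block_mx => /eq_block_mx[].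
  by apply: trmx_inj; rewrite trmx_mul trmxK pQ.1 QT tr_block_mx trmx0 trmx1 sY.
have J : coupling X Y = Xi *m P by rewrite /coupling -QX addrC addKr.
pose F := CK *m P; pose H := Xi *m BK.
pose M := (Y *m A + H *m C) *m X + (Y *m B *m CK + Xi *m AK) *m P.
have gramE : T^T *m Q *m T = lmi_gram X Y.
  rewrite TQ mulmx_block !(mulmx0, mul0mx, mul1mx, mulmx1, addr0, add0r).
  by rewrite QX.
have lyapE : T^T *m (- (Q *m K)) *m T = - lmi_lyap X Y F H M.
  rewrite mulmxN mulNmx mulmxA TQ; congr (- _).
  rewrite /K /closed_loop mulmx_block !(mul0mx, mul1mx, addr0) mulmx_block.
  by rewrite !(mulmx0, mulmx1, addr0) /lmi_lyap /F /H /M !mulmxA.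
have uJ : invmx (coupling X Y) = invmx P *m invmx Xi.
  by rewrite J invmxM.
exists X, Y, F, H, M, P; split=> //.
- by split; [rewrite -gramE; exact: posdef_congr|rewrite -lyapE; exact: posform_congr].
- have -> : lmiA X Y F H M = invmx P *m invmx Xi *m (Xi *m AK *m P).
    rewrite /lmiA uJ; congr (_ *m _); rewrite /M /F mulmxDl mulmxDl !mulmxA.
    move: (Y *m A *m X) (Y *m B *m CK *m P) (H *m C *m X) => a b c.
    by apply/matrixP => i j; rewrite !mxE; ring.
  by rewrite !mulmxA mulmxV // mul1mx mulVmx // mul1mx mulmxK.
- by rewrite /lmiB uJ /H !mulmxA mulmxV // mul1mx mulVmx // mul1mx.
- by rewrite /F mulmxK.
Qed.
End Param.

(** * Paths of matrices *)

Section MatrixContinuity.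
Variables (R : realType) (T : topologicalType).

(** Entrywise, so that matrix operations reduce to continuity of scalar sums and products. *)
Definition mxcontinuous m n (f : T -> 'M[R]_(m, n)) :=
  forall i j, continuous (fun t => f t i j).

Lemma mxcontinuousP m n (f : T -> 'M[R]_(m, n)) :
  mxcontinuous f <-> continuous f.
Proof.
split=> [cf t U [P MP sPU]|cf i j t].
  have : \forall x \near t, forall ij : 'I_m * 'I_n, P ij.1 ij.2 (f x ij.1 ij.2).
    by apply: filter_forall => ij; apply: cf; exact: MP.
  by apply: filterS => x Px; apply: sPU => i j; exact: Px (i, j).
apply: (@continuous_comp _ _ _ f (fun M : 'M[R]_(m, n) => M i j)); first exact: cf.
exact: coord_continuous.
Qed.

Lemma mxcontinuous_cst m n (M : 'M[R]_(m, n)) : mxcontinuous (fun=> M).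
Proof. by move=> i j t; exact: cvg_cst. Qed.

Lemma mxcontinuousD m n (f g : T -> 'M[R]_(m, n)) :
  mxcontinuous f -> mxcontinuous g -> mxcontinuous (fun t => f t + g t).
Proof.
move=> cf cg i j; under eq_fun do rewrite mxE.
by move=> t; apply: continuousD; [exact: cf|exact: cg].
Qed.

Lemma mxcontinuousN m n (f : T -> 'M[R]_(m, n)) :
  mxcontinuous f -> mxcontinuous (fun t => - f t).
Proof.
move=> cf i j; under eq_fun do rewrite mxE.
by move=> t; apply: continuousN; exact: cf.
Qed.

Lemma mxcontinuousZ m n (a : T -> R) (f : T -> 'M[R]_(m, n)) :
  continuous a -> mxcontinuous f -> mxcontinuous (fun t => a t *: f t).
Proof.
move=> ca cf i j; under eq_fun do rewrite mxE.
by move=> t; apply: continuousM; [exact: ca|exact: cf].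
Qed.

Lemma continuous_sum I (r : seq I) (F : I -> T -> R) :
  (forall i, continuous (F i)) -> continuous (fun t => \sum_(i <- r) F i t).
Proof. by move=> cF; apply: continuous_big => //; exact: add_continuous. Qed.

Lemma continuous_prod I (r : seq I) (F : I -> T -> R) :
  (forall i, continuous (F i)) -> continuous (fun t => \prod_(i <- r) F i t).
Proof. by move=> cF; apply: continuous_big => //; exact: mul_continuous. Qed.

Lemma mxcontinuousM m n p (f : T -> 'M[R]_(m, n)) (g : T -> 'M[R]_(n, p)) :
  mxcontinuous f -> mxcontinuous g -> mxcontinuous (fun t => f t *m g t).
Proof.
move=> cf cg i j; under eq_fun do rewrite mxE; apply: continuous_sum => k t.
by apply: continuousM; [exact: cf|exact: cg].
Qed.

Lemma continuous_det n (f : T -> 'M[R]_n) :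
  mxcontinuous f -> continuous (fun t => \det (f t)).
Proof.
move=> cf; apply: continuous_sum => s t.
have cp : continuous (fun t => \prod_i f t i (s i)).
  by apply: continuous_prod => i; exact: cf.
exact: (continuousM (cvg_cst _) (cp t)).
Qed.

Lemma mxcontinuous_inv n (f : T -> 'M[R]_n) :
  (forall t, f t \in unitmx) -> mxcontinuous f -> mxcontinuous (fun t => invmx (f t)).
Proof.
(* [invmx] returns its argument on singular matrices; invertibility at every time selects the
   adjugate formula. *)
move=> uf cf; under eq_fun do rewrite /invmx uf.
apply: mxcontinuousZ.
  move=> t; have d0 : \det (f t) != 0 by rewrite -unitfE -unitmxE.
  exact: (@continuousV _ _ (fun t => \det (f t)) t d0 (continuous_det cf (x := t))).
move=> i j; under eq_fun do rewrite mxE /cofactor.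
have cd : continuous (fun t => \det (row' j (col' i (f t)))).
  by apply: continuous_det => k l; under eq_fun do rewrite !mxE; exact: cf.
by move=> t; exact: (continuousM (cvg_cst _) (cd t)).
Qed.

Lemma mxcontinuous_block m1 m2 n1 n2 (f : T -> 'M[R]_(m1, n1))
    (g : T -> 'M[R]_(m1, n2)) (h : T -> 'M[R]_(m2, n1)) (k : T -> 'M[R]_(m2, n2)) :
  mxcontinuous f -> mxcontinuous g -> mxcontinuous h -> mxcontinuous k ->
  mxcontinuous (fun t => block_mx (f t) (g t) (h t) (k t)).
Proof.
move=> cf cg ch ck i j; rewrite -(splitK i) -(splitK j).
case: (fintype.split i) => i'; case: (fintype.split j) => j' /=.
- by under eq_fun do rewrite block_mxEul; exact: cf.
- by under eq_fun do rewrite block_mxEur; exact: cg.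
- by under eq_fun do rewrite block_mxEdl; exact: ch.
- by under eq_fun do rewrite block_mxEdr; exact: ck.
Qed.

Lemma mxcontinuous_trmx k l (f : T -> 'M[R]_(k, l)) :
  mxcontinuous f -> mxcontinuous (fun t => (f t)^T).
Proof. by move=> cf i j; under eq_fun do rewrite mxE; exact: cf. Qed.

Lemma mxcontinuous_dr m1 m2 n1 n2
    (f : T -> 'M[R]_(m1 + m2, n1 + n2)) :
  mxcontinuous f -> mxcontinuous (fun t => drsubmx (f t)).
Proof.
move=> cf i j.
have -> : (fun t => drsubmx (f t) i j) = (fun t => f t (rshift m1 i) (rshift n1 j)).
  by apply/funext => t; rewrite !mxE.
exact: cf.
Qed.

Lemma mxcontinuous_dl m1 m2 n1 n2
    (f : T -> 'M[R]_(m1 + m2, n1 + n2)) :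
  mxcontinuous f -> mxcontinuous (fun t => dlsubmx (f t)).
Proof.
move=> cf i j.
have -> : (fun t => dlsubmx (f t) i j) = (fun t => f t (rshift m1 i) (lshift n2 j)).
  by apply/funext => t; rewrite !mxE.
exact: cf.
Qed.

End MatrixContinuity.

Section Clamp.
Variable R : realType.

(* Composing with [clamp] makes a path on [0, 1] a total continuous function. *)
Definition clamp (t : R) : R := Num.max 0 (Num.min t 1).

Lemma clamp_continuous : continuous clamp.
Proof.
move=> t; have h := (@continuous_max R R (fun=> 0) (fun s => Num.min s 1) t).
apply: h.
  exact: cvg_cst.
by apply: (@continuous_min _ _ id (fun=> 1)); [exact: cvg_id|exact: cvg_cst].
Qed.

Lemma clamp01 t : 0 <= clamp t <= 1.
Proof. by rewrite /clamp le_max lexx /= ge_max ler01 ge_min lexx orbT. Qed.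

Lemma clamp_le0 t : t <= 0 -> clamp t = 0.
Proof. by move=> t0; apply/max_idPl; rewrite ge_min t0. Qed.

Lemma clamp_ge1 t : 1 <= t -> clamp t = 1.
Proof. by move=> t1; rewrite /clamp (min_idPr t1); apply/max_idPr. Qed.

End Clamp.

(** * Connectedness of the matrices of positive determinant *)

Section GLPath.
Variable R : realType.

Definition detpos_path n (G : 'M[R]_n) := exists f : R -> 'M[R]_n,
  [/\ mxcontinuous f, f 0 = 1%:M, f 1 = G & forall t, 0 < \det (f t)].

Lemma detpos_path_mul n (G1 G2 : 'M[R]_n) :
  detpos_path G1 -> detpos_path G2 -> detpos_path (G1 *m G2).
Proof.
move=> [f [cf f0 f1 df]] [g [cg g0 g1 dg]]; exists (fun t => f t *m g t); split.
- exact: mxcontinuousM.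
- by rewrite f0 g0 mulmx1.
- by rewrite f1 g1.
- by move=> t; rewrite det_mulmx mulr_gt0.
Qed.

Lemma detpos_path_lower n1 n2 (c : 'M[R]_(n2, n1)) :
  detpos_path (block_mx 1%:M 0 c 1%:M : 'M[R]_(n1 + n2)).
Proof.
exists (fun t => block_mx 1%:M 0 (t *: c) 1%:M); split.
- apply: mxcontinuous_block; try exact: mxcontinuous_cst.
  by apply: mxcontinuousZ; [move=> t; exact: cvg_id|exact: mxcontinuous_cst].
- by rewrite scale0r -scalar_mx_block.
- by rewrite scale1r.
- by move=> t; rewrite det_lblock !det1 mulr1.
Qed.

Lemma detpos_path_upper n1 n2 (b : 'M[R]_(n1, n2)) :
  detpos_path (block_mx 1%:M b 0 1%:M : 'M[R]_(n1 + n2)).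
Proof.
exists (fun t => block_mx 1%:M (t *: b) 0 1%:M); split.
- apply: mxcontinuous_block; try exact: mxcontinuous_cst.
  by apply: mxcontinuousZ; [move=> t; exact: cvg_id|exact: mxcontinuous_cst].
- by rewrite scale0r -scalar_mx_block.
- by rewrite scale1r.
- by move=> t; rewrite det_ublock !det1 mulr1.
Qed.

Lemma detpos_path_diag n1 n2 (G : 'M[R]_n2) :
  detpos_path G -> detpos_path (block_mx 1%:M 0 0 G : 'M[R]_(n1 + n2)).
Proof.
move=> [f [cf f0 f1 df]]; exists (fun t => block_mx 1%:M 0 0 (f t)); split.
- by apply: mxcontinuous_block => //; exact: mxcontinuous_cst.
- by rewrite f0 -scalar_mx_block.
- by rewrite f1.
- by move=> t; rewrite det_ublock det1 mul1r.
Qed.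

Lemma detpos_path_scalar1 (a : R) : 0 < a -> detpos_path (a%:M : 'M[R]_1).
Proof.
(* Clamping keeps the value between 1 and [a], hence positive, at all real times. *)
move=> a0; exists (fun t => 1%:M + clamp t *: (a - 1)%:M); split.
- apply: mxcontinuousD; first exact: mxcontinuous_cst.
  by apply: mxcontinuousZ; [exact: clamp_continuous|exact: mxcontinuous_cst].
- by rewrite clamp_le0 // scale0r addr0.
- by rewrite clamp_ge1 // scale1r -raddfD /= addrC subrK.
- move=> t; rewrite det_mx11 !mxE !mulr1n; have /andP[] := clamp01 t.
  move: (clamp t) => s s0 s1; have := mulr_ge0 s0 (ltW a0).
  have [->|sN1] := eqVneq s 1; first by rewrite mul1r; lra.
  have : s < 1 by rewrite lt_neqAle sN1.
  by rewrite mulrBr; lra.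
Qed.

(** Gaussian elimination by shears only, each joined to the identity inside determinant 1. The pivot
    is made equal to 1 by a shear, not by scaling, so the smaller block inherits the positive
    determinant. *)
Lemma detpos_path_exists n (G : 'M[R]_n) : 0 < \det G -> detpos_path G.
Proof.
elim: n G => [|n IH] G.
  exists (fun=> 1%:M); split=> //; first exact: mxcontinuous_cst.
    by rewrite [LHS]flatmx0 [RHS]flatmx0.
  by move=> t; rewrite det1.
move: G; change n.+1 with (1 + n)%N => G.
have corner1 (b : 'rV[R]_n) c D : 0 < \det (block_mx 1%:M b c D) ->
    detpos_path (block_mx 1%:M b c D).
  have -> : block_mx 1%:M b c D = block_mx 1%:M 0 c 1%:M *m
      (block_mx 1%:M 0 0 (D - c *m b) *m block_mx 1%:M b 0 1%:M).
    rewrite !mulmx_block !(mul1mx, mulmx1, mul0mx, mulmx0, addr0, add0r).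
    by rewrite addrC subrK.
  rewrite !det_mulmx det_lblock !det_ublock !det1 !(mul1r, mulr1) => /IH dG.
  apply: detpos_path_mul; first exact: detpos_path_lower.
  by apply: detpos_path_mul; [exact: detpos_path_diag|exact: detpos_path_upper].
have column (a : 'M[R]_1) (b : 'rV[R]_n) c D : c != 0 ->
    0 < \det (block_mx a b c D) -> detpos_path (block_mx a b c D).
  move=> c0; have [r rc] : exists r : 'rV[R]_n, r *m c = 1%:M - a.
    case/cV0Pn: c0 => i ci; exists (((1 - a 0 0) / c i 0) *: delta_mx 0 i).
    rewrite -scalemxAl -rowE; apply/matrixP => k l; rewrite !ord1 !mxE.
    by rewrite divfK.
  have -> : block_mx a b c D = block_mx 1%:M (- r) 0 1%:M *m
      block_mx 1%:M (b + r *m D) c D.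
    rewrite mulmx_block !(mul1mx, mulmx1, mul0mx, mulmx0, addr0, add0r).
    by rewrite !mulNmx rc addrK opprB addrC subrK.
  rewrite det_mulmx det_ublock !det1 !mul1r => dG.
  by apply: detpos_path_mul; [exact: detpos_path_upper|exact: corner1].
rewrite -(submxK G); move: (ulsubmx G) (ursubmx G) (dlsubmx G) (drsubmx G).
move=> a b c D dG; have [c0|] := eqVneq c 0; last by move/column; apply.
rewrite c0 in dG *; rewrite det_ublock in dG.
have a0 : \det a != 0 by apply: contraTneq dG => ->; rewrite mul0r ltxx.
move: b c c0 D dG {IH corner1 G}; case: n column => [|n] column b c c0 D dG.
  have -> : block_mx a b 0 D = block_mx a 0 0 1%:M :> 'M[R]_(1 + 0).
    by rewrite [b]thinmx0 [D]flatmx0 [1%:M]flatmx0.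
  have aE : 0 < a 0 0 by move: dG; rewrite det_mx00 mulr1 det_mx11.
  have [f [cf f0 f1 df]] := detpos_path_scalar1 aE.
  exists (fun t => block_mx (f t) 0 0 1%:M); split.
  - by apply: mxcontinuous_block => //; exact: mxcontinuous_cst.
  - by rewrite f0 -scalar_mx_block.
  - by rewrite f1 -mx11_scalar.
  - by move=> t; rewrite det_ublock det1 mulr1.
(* The column under the pivot is zero: adding the first row to all others makes it nonzero, because
   [a] is. *)
pose u : 'cV[R]_n.+1 := const_mx 1.
have -> : block_mx a b 0 D = block_mx 1%:M 0 (- u) 1%:M *m
    block_mx a b (u *m a) (u *m b + D).
  rewrite mulmx_block !(mul1mx, mulmx1, mul0mx, mulmx0, addr0, add0r).
  by rewrite !mulNmx addNr addKr.
have dE : \det (block_mx a b (u *m a) (u *m b + D)) = \det a * \det D.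
  have -> : block_mx a b (u *m a) (u *m b + D) =
      block_mx 1%:M 0 u 1%:M *m block_mx a b 0 D.
    by rewrite mulmx_block !(mul1mx, mulmx1, mul0mx, mulmx0, addr0, add0r).
  by rewrite det_mulmx det_lblock !det1 !mul1r det_ublock.
apply: detpos_path_mul; first exact: detpos_path_lower.
apply: column; last by rewrite dE.
apply: contra a0 => /eqP/matrixP/(_ 0 0); rewrite !mxE big_ord1 !mxE mul1r.
by rewrite det_mx11 => ->.
Qed.

End GLPath.

(** * Controllers of lower order *)

Section Reduction.
Variable (F : fieldType) (n : nat).

(** Kalman matrix of a single-input pair: it is square, so its determinant decides
    controllability. *)
Definition ctrb (A : 'M[F]_n.+1) (B : 'cV[F]_n.+1) : 'M[F]_n.+1 :=
  \matrix_(i, j) (A ^+ j *m B) i 0.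

Lemma ctrb_mul A B (z : 'cV_n.+1) :
  ctrb A B *m z = \sum_(i < n.+1) z i 0 *: (A ^+ i *m B).
Proof.
apply/colP => k; rewrite summxE mxE; apply: eq_bigr => i _.
by rewrite [RHS]mxE mxE mulrC.
Qed.

Lemma ctrb_span A B k : exists z, A ^+ k *m B = ctrb A B *m z.
Proof.
(* By Cayley-Hamilton, [A ^+ k] is a polynomial in [A] of degree at most [n]. *)
pose q := 'X^k %% char_poly A.
have qE : horner_mx A q = A ^+ k.
  have := congr1 (horner_mx A) (divp_eq 'X^k (char_poly A)).
  rewrite rmorphD rmorphM /= Cayley_Hamilton mulr0 add0r => <-.
  by rewrite rmorphXn /= horner_mx_X.
have sq : (size q <= n.+1)%N.
  rewrite -ltnS -(size_char_poly A) ltn_modp -size_poly_eq0.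
  by rewrite size_char_poly.
have qS : q = \sum_(i < n.+1) q`_i *: 'X^i.
  rewrite -poly_def; apply/polyP => i; rewrite coef_poly.
  by case: ltnP => // ni; rewrite nth_default // (leq_trans sq).
exists (\col_i q`_i); rewrite ctrb_mul -qE {1}qS rmorph_sum /= mulmx_suml.
apply: eq_bigr => i _; rewrite mxE linearZ /= rmorphXn /= horner_mx_X.
by rewrite scalemxAl.
Qed.

(* [E] is a basis of the reachable subspace and [L] a left inverse of it. *)
Lemma ctrb_invariant A B : exists k : nat, exists (E : 'M[F]_(n.+1, k)) L A1 B1,
  [/\ (\det (ctrb A B) = 0 -> (k <= n)%N), L *m E = 1%:M, A *m E = E *m A1 &
      B = E *m B1].
Proof.
pose O := ctrb A B; exists (\rank O).
move: (col_base O) (row_base O) (mulmx_base O) (col_base_full O) (row_base_free O).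
move=> E r Er /row_fullP[L LE] /row_freeP[Y rY].
have OE : E = O *m Y by have := congr1 (mulmx^~ Y) Er; rewrite -mulmxA rY mulmx1.
(* [A] shifts the columns of [O]; the last one stays in the span by [ctrb_span]. Hence the reachable
   subspace is invariant. *)
have [X AO] : exists X, A *m O = O *m X.
  have /fin_all_exists[z zP] : forall j : 'I_n.+1, exists z, A ^+ j.+1 *m B = O *m z.
    by move=> j; exact: ctrb_span.
  exists (\matrix_(i, j) z j i 0); apply/matrixP => i j.
  have /colP/(_ i) := zP j; rewrite [RHS]mxE => zE.
  transitivity ((A ^+ j.+1 *m B) i 0).
    rewrite exprS -mulmxA !mxE; apply: eq_bigr => k _; congr (_ * _).
    by rewrite mxE.
  by rewrite zE mxE; apply: eq_bigr => k _; rewrite !mxE.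
have [Z BO] := ctrb_span A B 0; rewrite expr0 mul1mx in BO.
exists E, L, (r *m X *m Y), (r *m Z); split=> //.
- move=> d0; rewrite -ltnS ltn_neqAle rank_leq_row andbT.
  by rewrite -/(row_free O) row_free_unit unitmxE d0 unitr0.
- by rewrite !mulmxA Er -AO OE !mulmxA.
- by rewrite mulmxA Er.
Qed.

Lemma ctrb_similar A B P : P \in unitmx ->
  ctrb (P *m A *m invmx P) (P *m B) = P *m ctrb A B.
Proof.
move=> uP; apply/matrixP => i j; rewrite mxE.
have -> : (P *m A *m invmx P) ^+ j *m (P *m B) = P *m (A ^+ j *m B).
  elim: (j : nat) => [|k IH]; first by rewrite !expr0 !mul1mx.
  rewrite !exprS -[LHS](mulmxA (P *m A *m invmx P)) IH -[in RHS]mulmxA.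
  by rewrite -!(mulmxA P) -(mulmxA A) (mulKmx uP).
by rewrite mxE [RHS]mxE; apply: eq_bigr => k _; rewrite [X in _ = _ * X]mxE.
Qed.

End Reduction.

(** * Changing the order of a controller; existence at full order *)

Section Controllers.
Variable R : realType.
Local Notation C := (complex R).
Local Notation rc := (real_complex R).

Lemma stable_closed_loopP n m p q (A : 'M[R]_n) (B : 'M[R]_(n, m))
    (D : 'M[R]_(p, n)) (AK : 'M[R]_q) BK CK :
  stable (closed_loop A B D AK BK CK) <->
  forall (a : C) (x : 'cV_n) (y : 'cV_q), (x != 0) || (y != 0) ->
    map_mx rc A *m x + map_mx rc (B *m CK) *m y = a *: x ->
    map_mx rc (BK *m D) *m x + map_mx rc AK *m y = a *: y -> complex.Re a < 0.
Proof.
rewrite stable_colP; split=> [h a x y xy0 Ex Ey|h a x].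
  apply: (h a (col_mx x y)); first by rewrite col_mx_eq0 negb_and.
  by rewrite map_block_mx mul_block_col scale_col_mx Ex Ey.
rewrite -(vsubmxK x) col_mx_eq0 negb_and map_block_mx mul_block_col scale_col_mx.
by move=> xy0 /eq_col_mx[Ex Ey]; exact: h xy0 Ex Ey.
Qed.

Section Augment.
Variables (n m p q : nat) (A : 'M[R]_n) (B : 'M[R]_(n, m)) (D : 'M[R]_(p, n)).
Variables (AK : 'M[R]_q) (BK : 'M[R]_(q, p)) (CK : 'M[R]_(m, q)).

(** An eigenvector either has zero new coordinate, hence comes from the original loop, or belongs to
    the eigenvalue -1. *)
Lemma stable_augment : stable (closed_loop A B D AK BK CK) ->
  stable (closed_loop A B D (block_mx (-1)%:M 0 0 AK : 'M[R]_(1 + q))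
            (col_mx 0 BK) (row_mx 0 CK)).
Proof.
move=> /stable_closed_loopP sK; apply/stable_closed_loopP => a x y.
rewrite -(vsubmxK y); move: (usubmx y) (dsubmx y) => y1 y2.
rewrite mul_mx_row mulmx0 mul_col_mx mul0mx map_row_mx map_col_mx map_block_mx.
rewrite !map_mx0 mul_row_col mul0mx add0r mul_col_mx mul0mx.
rewrite mul_block_col !mul0mx addr0 add0r add_col_mx add0r scale_col_mx.
move=> xy Ex /eq_col_mx[Ey1 Ey2].
have [y10|y10] := eqVneq y1 0.
  by apply: sK Ex Ey2; move: xy; rewrite y10 col_mx_eq0 eqxx.
suff -> : a = -1 by rewrite /= oppr_lt0 ltr01.
apply/eqP; rewrite -subr_eq0; apply: contraNT y10 => a0.
move: Ey1; rewrite map_scalar_mx mul_scalar_mx => /eqP.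
rewrite -subr_eq0 -scalerBl scaler_eq0 => /orP[|//].
by rewrite rmorphN rmorph1 -oppr_eq0 opprB (negbTE a0).
Qed.

End Augment.

Lemma stabilizing_nonemptyS n m p q (A : 'M[R]_n) (B : 'M[R]_(n, m))
    (D : 'M[R]_(p, n)) :
  stabilizing_controllers A B D q !=set0 ->
  stabilizing_controllers A B D q.+1 !=set0.
Proof.
move=> [_ [AK [BK [CK [_ sK]]]]].
by eexists; do 3!eexists; split; [reflexivity|exact: (stable_augment sK)].
Qed.

Lemma stabilizing_nonempty_le n m p q q' (A : 'M[R]_n) (B : 'M[R]_(n, m))
    (D : 'M[R]_(p, n)) : (q <= q')%N ->
  stabilizing_controllers A B D q !=set0 ->
  stabilizing_controllers A B D q' !=set0.
Proof.
elim: q' => [|k IH]; first by rewrite leqn0 => /eqP->.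
rewrite leq_eqVlt => /predU1P[->//|]; rewrite ltnS => qk q0.
by apply: stabilizing_nonemptyS; exact: IH.
Qed.

(** [E] is injective and intertwines the controllers, so it carries eigenvectors of the small loop
    to eigenvectors of the large one. *)
Lemma stable_reduce n m p q k (A : 'M[R]_n) (B : 'M[R]_(n, m)) (D : 'M[R]_(p, n))
    (AK : 'M[R]_q) BK CK (E : 'M[R]_(q, k)) L A1 B1 :
  L *m E = 1%:M -> AK *m E = E *m A1 -> BK = E *m B1 ->
  stable (closed_loop A B D AK BK CK) ->
  stable (closed_loop A B D A1 B1 (CK *m E)).
Proof.
move=> LE AE BE /stable_closed_loopP sK; apply/stable_closed_loopP => a x y xy Ex Ey.
apply: (sK a x (map_mx rc E *m y)).
- case/orP: xy => [->//|y0]; apply/orP; right; apply: contra y0 => /eqP Ey0.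
  by rewrite -[y]mul1mx -(map_mx1 rc) -LE map_mxM -mulmxA Ey0 mulmx0.
- by rewrite -Ex mulmxA -map_mxM mulmxA.
- rewrite scalemxAr -Ey BE mulmxDr !mulmxA -!map_mxM AE.
  by rewrite -mulmxA.
Qed.

Lemma stable_trmx n (M : 'M[R]_n) : stable M -> stable M^T.
Proof.
move=> sM; apply/stable_colP => a x x0 Mx; apply: sM; apply/eigenvalueP.
exists x^T; last by rewrite trmx_eq0.
by rewrite -[map_mx _ _]trmxK -trmx_mul map_trmx Mx linearZ.
Qed.

Lemma stabilizing_trmx n m p q (A : 'M[R]_n) (B : 'M[R]_(n, m))
    (D : 'M[R]_(p, n)) K :
  stabilizing_controllers A B D q K ->
  stabilizing_controllers A^T D^T B^T q K^T.
Proof.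
move=> [AK [BK [CK [-> sK]]]]; exists AK^T, CK^T, BK^T; split.
  by rewrite tr_block_mx trmx0.
have := stable_trmx sK; congr stable.
by rewrite /closed_loop tr_block_mx !trmx_mul.
Qed.

(** An eigenvector killed by [D] is killed by every [D A^k], which observability forbids; the Hautus
    condition is then vacuous. *)
Lemma detectable_stabilizable n p (A : 'M[R]_n.+1) (D : 'M[R]_(p, n.+1)) :
  observable D A -> exists L, stable (A + L *m D).
Proof.
move=> obs; have [|P [L PL]] := @lyap_detect _ _ _ A D; last first.
  by exists L; exact: lyap_stable PL.
move=> a x x0 Ax Dx; case/negP: x0; apply/eqP.
have /row_fullP[V VO] : row_full (\mxcol_(i < n.+1) (D *m A ^+ i)) by apply/eqP.
rewrite -[x]mul1mx -(map_mx1 rc) -VO map_mxM -mulmxA.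
suff -> : map_mx rc (\mxcol_(i < n.+1) (D *m A ^+ i)) *m x = 0 by rewrite mulmx0.
have Dk k : map_mx rc (D *m A ^+ k) *m x = 0.
  have -> : map_mx rc (D *m A ^+ k) *m x = a ^+ k *: (map_mx rc D *m x).
    rewrite map_mxM -mulmxA scalemxAr; congr (_ *m _).
    elim: k => [|k IH]; first by rewrite !expr0 map_mx1 mul1mx scale1r.
    rewrite exprSr exprSr map_mxM -mulmxA Ax -scalemxAr IH scalerA.
    by rewrite mulrC.
  by rewrite Dx scaler0.
apply/colP => r; rewrite mxE [RHS]mxE.
transitivity ((map_mx rc (D *m A ^+ tagnat.sig1 r) *m x) (tagnat.sig2 r) 0).
  by rewrite mxE; apply: eq_bigr => j _; rewrite !mxE.
by rewrite Dk mxE.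
Qed.

Lemma observable_trmx n m (A : 'M[R]_n.+1) (B : 'M[R]_(n.+1, m)) :
  controllable A B -> observable B^T A^T.
Proof.
rewrite /controllable /observable => cAB; rewrite -[RHS]cAB -[RHS]mxrank_tr tr_mxrow.
congr (\rank _); apply/eq_mxcolP => i; rewrite trmx_mul; congr (_ *m _).
elim: (i : nat) => [|k IH]; first by rewrite !expr0 trmx1.
by rewrite exprS exprSr IH; exact: esym (trmx_mul _ _).
Qed.

(** Observer-based controller: for an eigenvector [(x, y)], either [y = x] and [x] is an eigenvector
    of [A + B F], or the estimation error [y - x] is one of [A + L D]. *)
Lemma stabilizing_nonempty n m p (A : 'M[R]_n.+1) (B : 'M[R]_(n.+1, m))
    (D : 'M[R]_(p, n.+1)) : controllable A B -> observable D A ->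
  stabilizing_controllers A B D n.+1 !=set0.
Proof.
move=> /observable_trmx/detectable_stabilizable[F0 /stable_trmx].
move=> + /detectable_stabilizable[L /stable_colP sL].
rewrite linearD /= trmx_mul !trmxK; set F := F0^T => /stable_colP sF.
eexists; exists (A + B *m F + L *m D), (- L), F; split; first reflexivity.
apply/stable_closed_loopP => a x y xy Ex Ey.
have [yx|yx] := eqVneq y x.
  apply: (sF a x); first by move: xy; rewrite yx orbb.
  by rewrite -Ex yx map_mxD mulmxDl.
apply: (sL a (y - x)); first by rewrite subr_eq0.
rewrite scalerBr -Ex -Ey mulNmx map_mxN !map_mxD mulmxBr !mulmxDl mulNmx.
move: (map_mx rc A *m x) (map_mx rc A *m y) (map_mx rc (L *m D) *m x)
  (map_mx rc (L *m D) *m y) (map_mx rc (B *m F) *m y) => k1 k2 k3 k4 k5.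
by apply/colP => i; rewrite !mxE; ring.
Qed.

End Controllers.

(** * Path-connectedness *)

Section Joined.
Variables (R : realType) (m n : nat) (S : set 'M[R]_(m, n)).

Definition joined (x y : 'M[R]_(m, n)) := exists f : R -> 'M[R]_(m, n),
  [/\ mxcontinuous f, f 0 = x, f 1 = y & forall t, S (f t)].

Lemma joined_trans x y z : joined x y -> joined y z -> joined x z.
Proof.
move=> [f [cf f0 f1 Sf]] [g [cg g0 g1 Sg]].
(* At each time one of the first two summands equals [y]. *)
exists (fun t => f (clamp (2 * t)) + g (clamp (2 * t - 1)) - y).
have cl (h : R -> 'M[R]_(m, n)) (c : R) : mxcontinuous h ->
    mxcontinuous (fun t : R => h (clamp (2 * t - c))).
  move=> ch i j t; have c1 : {for t, continuous (fun t : R => 2 * t - c)}.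
    by apply: cvgB; [apply: cvgM; [exact: cvg_cst|exact: cvg_id]|exact: cvg_cst].
  have c2 := continuous_comp c1 (@clamp_continuous R (2 * t - c)).
  exact: (continuous_comp c2 (ch i j (clamp (2 * t - c)))).
split.
- apply: mxcontinuousD; last exact: mxcontinuous_cst.
  apply: mxcontinuousD; last exact: cl.
  by have := cl f 0 cf; under eq_fun do rewrite subr0.
- by rewrite mulr0 !clamp_le0 ?sub0r ?oppr_le0 // f0 g0 addrK.
- by rewrite mulr1 !clamp_ge1 ?f1 ?g1 1?addrAC ?subrr ?add0r //; lra.
- move=> t; have [t2|t2] := leP t (1 / 2).
    by rewrite [clamp (2 * t - 1)]clamp_le0 ?g0 ?addrK //; lra.
  by rewrite [clamp (2 * t)]clamp_ge1 ?f1 1?addrAC ?subrr ?add0r //; lra.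
Qed.

Lemma joined_path_connected :
  (forall x y, S x -> S y -> joined x y) -> path_connected R S.
Proof.
move=> h x y Sx Sy; have [f [cf f0 f1 Sf]] := h x y Sx Sy.
exists f; split=> //; apply: continuous_subspaceT; exact/mxcontinuousP.
Qed.

End Joined.

Section Convex.
Variable R : realType.

Definition mix m n (s : R) (U V : 'M[R]_(m, n)) := (1 - s) *: U + s *: V.

Lemma mixN m n s (U V : 'M[R]_(m, n)) : - mix s U V = mix s (- U) (- V).
Proof. by rewrite /mix opprD !scalerN. Qed.

Lemma mixUU m n s (U : 'M[R]_(m, n)) : mix s U U = U.
Proof. by rewrite /mix -scalerDl subrK scale1r. Qed.

Lemma mulmx_mix m n p s (A : 'M[R]_(m, n)) (U V : 'M[R]_(n, p)) :
  A *m mix s U V = mix s (A *m U) (A *m V).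
Proof. by rewrite /mix mulmxDr !scalemxAr. Qed.

Lemma mix_mulmx m n p s (A : 'M[R]_(n, p)) (U V : 'M[R]_(m, n)) :
  mix s U V *m A = mix s (U *m A) (V *m A).
Proof. by rewrite /mix mulmxDl !scalemxAl. Qed.

Lemma mixD m n s (U V U' V' : 'M[R]_(m, n)) :
  mix s U V + mix s U' V' = mix s (U + U') (V + V').
Proof. by rewrite /mix !scalerDr addrACA. Qed.

Lemma mix_block m1 m2 n1 n2 s (U1 V1 : 'M[R]_(m1, n1)) (U2 V2 : 'M[R]_(m1, n2))
    (U3 V3 : 'M[R]_(m2, n1)) (U4 V4 : 'M[R]_(m2, n2)) :
  block_mx (mix s U1 V1) (mix s U2 V2) (mix s U3 V3) (mix s U4 V4) =
  mix s (block_mx U1 U2 U3 U4) (block_mx V1 V2 V3 V4).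
Proof. by rewrite /mix !scale_block_mx add_block_mx. Qed.

Lemma mix0 m n (U V : 'M[R]_(m, n)) : mix 0 U V = U.
Proof. by rewrite /mix subr0 scale1r scale0r addr0. Qed.

Lemma mix1 m n (U V : 'M[R]_(m, n)) : mix 1 U V = V.
Proof. by rewrite /mix subrr scale1r scale0r add0r. Qed.

Lemma posform_mix n s (U V : 'M[R]_n) :
  0 <= s <= 1 -> posform U -> posform V -> posform (mix s U V).
Proof.
move=> /andP[s0 s1] pU pV x x0; rewrite mulmx_mix mix_mulmx.
have := pU _ x0; have := pV _ x0.
move: (x^T *m U *m x) (x^T *m V *m x) => u v; rewrite !mxE => v0 u0.
have [->|sN0] := eqVneq s 0; first by rewrite subr0 mul1r mul0r addr0.
rewrite ltr_wpDl //; first by rewrite mulr_ge0 ?subr_ge0 // ltW.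
by rewrite mulr_gt0 // lt0r sN0.
Qed.

Lemma posdef_mix n s (U V : 'M[R]_n) :
  0 <= s <= 1 -> posdef U -> posdef V -> posdef (mix s U V).
Proof.
move=> s01 [sU pU] [sV pV]; split; last exact: posform_mix.
by rewrite /mix linearD !linearZ /= sU sV.
Qed.

Lemma mxcontinuous_mix (T : topologicalType) m n (a : T -> R) (U V : 'M[R]_(m, n)) :
  continuous a -> mxcontinuous (fun t => mix (a t) U V).
Proof.
move=> ca; apply: mxcontinuousD; apply: mxcontinuousZ; try exact: mxcontinuous_cst.
  by move=> t; apply: cvgB; [exact: cvg_cst|exact: ca].
exact: ca.
Qed.

End Convex.

Section Paths.
Variables (R : realType) (n m p : nat).
Variables (A : 'M[R]_n) (B : 'M[R]_(n, m)) (D : 'M[R]_(p, n)).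
Local Notation Sn := (stabilizing_controllers A B D n).

Lemma lmi_mix s X Y F H M X' Y' F' H' M' : 0 <= s <= 1 ->
  lmi A B D X Y F H M -> lmi A B D X' Y' F' H' M' ->
  lmi A B D (mix s X X') (mix s Y Y') (mix s F F') (mix s H H') (mix s M M').
Proof.
move=> s01 [pZ pN] [pZ' pN']; split.
  suff -> : lmi_gram (mix s X X') (mix s Y Y') =
      mix s (lmi_gram X Y) (lmi_gram X' Y') by exact: posdef_mix.
  by rewrite /lmi_gram -mix_block !mixUU.
suff -> : lmi_lyap A B D (mix s X X') (mix s Y Y') (mix s F F') (mix s H H')
    (mix s M M') = mix s (lmi_lyap A B D X Y F H M) (lmi_lyap A B D X' Y' F' H' M').
  by rewrite mixN; exact: posform_mix.
by rewrite /lmi_lyap -mix_block mixUU -!mixD -!mulmx_mix -!mix_mulmx.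
Qed.

Definition lmi_ctrl X Y F H M (P : 'M[R]_n) : 'M[R]_(m + n, p + n) :=
  block_mx 0 (F *m invmx P) (P *m lmiB X Y H) (P *m lmiA A B D X Y F H M *m invmx P).

Lemma lmi_ctrl_stabilizing X Y F H M P :
  lmi A B D X Y F H M -> P \in unitmx -> Sn (lmi_ctrl X Y F H M P).
Proof.
move=> hl uP; do 3!eexists; split; first reflexivity.
by apply: stable_similar => //; exact: lmi_stable.
Qed.

Lemma lmi_ctrl_exists K : Sn K -> exists X Y F H M P,
  [/\ lmi A B D X Y F H M, P \in unitmx & K = lmi_ctrl X Y F H M P].
Proof.
move=> [AK [BK [CK [-> /stable_lmi[X [Y [F [H [M [P [hl uP -> -> ->]]]]]]]]]]].
by exists X, Y, F, H, M, P.
Qed.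

(** The LMI data follow a segment, and [P] follows [g t *m P] with [g] from the identity to
    [P' P^-1]. The inverses stay defined because the inequalities hold all along. *)
Lemma lmi_ctrl_joined X Y F H M P X' Y' F' H' M' P' :
  lmi A B D X Y F H M -> lmi A B D X' Y' F' H' M' -> P \in unitmx ->
  0 < \det (P' *m invmx P) ->
  joined Sn (lmi_ctrl X Y F H M P) (lmi_ctrl X' Y' F' H' M' P').
Proof.
move=> hl hl' uP /detpos_path_exists[g [cg g0 g1 dg]].
pose c := @clamp R.
pose Xt t := mix (c t) X X'; pose Yt t := mix (c t) Y Y'.
pose Ft t := mix (c t) F F'; pose Ht t := mix (c t) H H'.
pose Mt t := mix (c t) M M'; pose Pt t := g t *m P.
have ht t : lmi A B D (Xt t) (Yt t) (Ft t) (Ht t) (Mt t).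
  by apply: lmi_mix => //; exact: clamp01.
have ut t : Pt t \in unitmx.
  by rewrite unitmx_mul uP andbT unitmxE unitfE gt_eqF.
exists (fun t => lmi_ctrl (Xt t) (Yt t) (Ft t) (Ht t) (Mt t) (Pt t)); split.
- have cc := @clamp_continuous R.
  have cP : mxcontinuous Pt by apply: mxcontinuousM => //; exact: mxcontinuous_cst.
  have cV : mxcontinuous (fun t => invmx (Pt t)) by exact: mxcontinuous_inv.
  have cX : mxcontinuous Xt by exact: mxcontinuous_mix.
  have cY : mxcontinuous Yt by exact: mxcontinuous_mix.
  have cF : mxcontinuous Ft by exact: mxcontinuous_mix.
  have cH : mxcontinuous Ht by exact: mxcontinuous_mix.
  have cM : mxcontinuous Mt by exact: mxcontinuous_mix.
  have cst a b (U : 'M[R]_(a, b)) := @mxcontinuous_cst R R a b U.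
  have cJ : mxcontinuous (fun t => invmx (coupling (Xt t) (Yt t))).
    apply: mxcontinuous_inv; first by move=> t; apply: lmi_coupling_unit; case: (ht t).
    apply: mxcontinuousD => //; apply: mxcontinuousN; exact: mxcontinuousM.
  have cB : mxcontinuous (fun t => lmiB (Xt t) (Yt t) (Ht t)) by exact: mxcontinuousM.
  have cA : mxcontinuous (fun t => lmiA A B D (Xt t) (Yt t) (Ft t) (Ht t) (Mt t)).
    apply: mxcontinuousM => //.
    do 3?[apply: mxcontinuousD; last (apply: mxcontinuousN;
      do 2?[apply: mxcontinuousM => //])] => //.
  apply: mxcontinuous_block.
  + exact: mxcontinuous_cst.
  + exact: mxcontinuousM cF cV.
  + exact: mxcontinuousM cP cB.
  + exact: mxcontinuousM (mxcontinuousM cP cA) cV.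
- by rewrite /Xt /Yt /Ft /Ht /Mt /Pt /c clamp_le0 // !mix0 g0 mul1mx.
- by rewrite /Xt /Yt /Ft /Ht /Mt /Pt /c clamp_ge1 // !mix1 g1 mulmxKV.
- by move=> t; exact: lmi_ctrl_stabilizing.
Qed.

End Paths.

(** * Reflections and the two implications *)

Section Main.
Variable R : realType.

Definition reflection n : 'M[R]_(1 + n) := block_mx (-1)%:M 0 0 1%:M.

Lemma det_reflection n : \det (reflection n) = -1.
Proof. by rewrite det_ublock det1 mulr1 det_scalar1. Qed.

Lemma reflectionK n : reflection n *m reflection n = 1%:M.
Proof.
rewrite mulmx_block !(mulmx0, mul0mx, mulmx1, addr0, add0r) -scalar_mxM mulrNN.
by rewrite mulr1 -scalar_mx_block.
Qed.

Lemma reflection_unit n : reflection n \in unitmx.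
Proof. by case: (mulmx1_unit (reflectionK n)). Qed.

Lemma invmx_reflection n : invmx (reflection n) = reflection n.
Proof.
by rewrite -[LHS]mulmx1 -(reflectionK n) mulKmx // reflection_unit.
Qed.

Lemma row_mx_reflection k n (U : 'M[R]_(k, n)) :
  row_mx 0 U *m reflection n = row_mx 0 U.
Proof. by rewrite mul_row_block !mul0mx mulmx0 mulmx1 !add0r. Qed.

Lemma reflection_col_mx k n (U : 'M[R]_(n, k)) :
  reflection n *m col_mx 0 U = col_mx 0 U.
Proof. by rewrite mul_block_col !mulmx0 mul0mx mul1mx !add0r. Qed.

Lemma reflection_block_mx n (U : 'M[R]_n) :
  reflection n *m block_mx (-1)%:M 0 0 U *m reflection n = block_mx (-1)%:M 0 0 U.
Proof.
rewrite !mulmx_block !(mulmx0, mul0mx, mulmx1, mul1mx, addr0, add0r).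
by rewrite -!scalar_mxM mulrNN mulr1 mul1r.
Qed.

Lemma path_connected_of_reduced n m p (A : 'M[R]_n.+1) (B : 'M[R]_(n.+1, m))
    (D : 'M[R]_(p, n.+1)) :
  stabilizing_controllers A B D n !=set0 ->
  path_connected R (stabilizing_controllers A B D n.+1).
Proof.
move=> [_ [AK [BK [CK [_ /stable_augment sK]]]]].
pose K : 'M[R]_(m + (1 + n), p + (1 + n)) :=
  block_mx 0 (row_mx 0 CK) (col_mx 0 BK) (block_mx (-1)%:M 0 0 AK).
have SK : stabilizing_controllers A B D n.+1 K.
  by do 3!eexists; split; [reflexivity|exact: sK].
have [X [Y [F [H [M [P [hl uP KE]]]]]]] := lmi_ctrl_exists SK.
pose P' : 'M[R]_n.+1 := reflection n *m P.
have uS : reflection n \in unitmx := reflection_unit n.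
have uP' : P' \in unitmx by rewrite unitmx_mul uP andbT.
(* The reflection fixes [K], so the same LMI data represent [K] with [P] and with [P'], of opposite
   determinants. *)
have KE' : K = lmi_ctrl A B D X Y F H M P'.
  rewrite /lmi_ctrl /P' invmxM // invmx_reflection.
  have /esym/eq_block_mx[_] := KE.
  move: (lmiA A B D X Y F H M) (lmiB X Y H) => LA LB EF EB EA.
  rewrite mulmxA EF -!(mulmxA (reflection n)) EB !mulmxA -!(mulmxA (reflection n)) EA.
  rewrite /K (row_mx_reflection CK) (reflection_col_mx BK) mulmxA.
  by rewrite (reflection_block_mx AK).
have flip (G : 'M[R]_n.+1) : G \in unitmx -> exists P0 : 'M[R]_n.+1, [/\ P0 \in unitmx,
    K = lmi_ctrl A B D X Y F H M P0 & 0 < \det P0 * \det G].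
  move=> uG; have : \det P * \det G != 0.
    by rewrite mulf_neq0 // -unitfE -unitmxE.
  rewrite neq_lt => /orP[d0|d0]; last by exists P.
  exists P'; split=> //; rewrite det_mulmx det_reflection mulN1r mulNr.
  by rewrite oppr_gt0.
have det_div (G G' : 'M[R]_n.+1) : G' \in unitmx -> 0 < \det G * \det G' ->
    0 < \det (G *m invmx G').
  move=> uG' dG; rewrite det_mulmx det_inv; move: uG'; rewrite unitmxE unitfE => dG'.
  have -> : \det G * (\det G')^-1 = (\det G * \det G') * ((\det G')^-1) ^+ 2.
    by field.
  by rewrite mulr_gt0 // exprn_even_gt0 //= invr_eq0.
apply: joined_path_connected => K1 K2.
move=> /lmi_ctrl_exists[X1 [Y1 [F1 [H1 [M1 [P1 [hl1 uP1 ->]]]]]]].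
move=> /lmi_ctrl_exists[X2 [Y2 [F2 [H2 [M2 [P2 [hl2 uP2 ->]]]]]]].
apply: (joined_trans (y := K)).
  have [P0 [uP0 -> d0]] := flip P1 uP1.
  by apply: lmi_ctrl_joined => //; exact: det_div.
have [P0 [uP0 -> d0]] := flip P2 uP2.
by apply: lmi_ctrl_joined => //; apply: det_div => //; rewrite mulrC.
Qed.

Lemma mxcontinuous_ctrb (T : topologicalType) n (f : T -> 'M[R]_n.+1)
    (g : T -> 'cV[R]_n.+1) :
  mxcontinuous f -> mxcontinuous g -> mxcontinuous (fun t => ctrb (f t) (g t)).
Proof.
move=> cf cg i j; under eq_fun do rewrite mxE.
suff : mxcontinuous (fun t => f t ^+ j *m g t) by apply.
elim: (j : nat) => [|k IH].
  by under eq_fun do rewrite expr0 mul1mx.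
under eq_fun do rewrite exprS -mulmxA.
exact: mxcontinuousM.
Qed.

Lemma reduced_of_path_connected n m (A : 'M[R]_n.+1) (B : 'M[R]_(n.+1, m))
    (D : 'M[R]_(1, n.+1)) :
  stabilizing_controllers A B D n.+1 !=set0 ->
  path_connected R (stabilizing_controllers A B D n.+1) ->
  stabilizing_controllers A B D n !=set0.
Proof.
move=> [K0 SK0] pc; have [AK [BK [CK [K0E sK]]]] := SK0.
pose S : 'M[R]_n.+1 := reflection n.
have uS : S \in unitmx := reflection_unit n.
pose K1 : 'M[R]_(m + n.+1, 1 + n.+1) :=
  block_mx 0 (CK *m invmx S) (S *m BK) (S *m AK *m invmx S).
have SK1 : stabilizing_controllers A B D n.+1 K1.
  by do 3!eexists; split; [reflexivity|exact: stable_similar].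
have [f [cf f0 f1 Sf]] := pc K0 K1 SK0 SK1.
pose h (K : 'M[R]_(m + n.+1, 1 + n.+1)) : R := \det (ctrb (drsubmx K) (dlsubmx K)).
have ch : {within `[0 : R, 1], continuous (h \o f)}.
  (* The path is continuous only within the interval, so its parameter lives in the subspace
     topology. *)
  have {}cf : mxcontinuous (f : subspace `[0 : R, 1] -> _) by exact/mxcontinuousP.
  exact: continuous_det (mxcontinuous_ctrb (mxcontinuous_dr cf) (mxcontinuous_dl cf)).
have h1 : h K1 = - h K0.
  rewrite /h /K1 K0E !block_mxKdr !block_mxKdl ctrb_similar //.
  by rewrite det_mulmx det_reflection mulN1r.
have [|c c01 hc] := IVT (ler01 : (0 : R) <= 1) ch (v := 0).
  rewrite /= f0 f1 h1; case: (lerP 0 (h K0)) => hK.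
    by rewrite ge_min le_max hK oppr_le0 hK orbT.
  by rewrite ge_min le_max oppr_ge0 (ltW hK) orbT.
have := Sf c c01; move: hc => /= + [AK' [BK' [CK' [KE sK']]]].
rewrite /h KE block_mxKdr block_mxKdl => d0.
have [k [E [L [A1 [B1 [/(_ d0) kn LE AE BE]]]]]] := ctrb_invariant AK' BK'.
(* The reachable dimension [k] may be less than [n]; decoupled stable modes raise the order to
   exactly [n]. *)
apply: (stabilizing_nonempty_le kn).
eexists; exists A1, B1, (CK' *m E); split; first reflexivity.
exact: stable_reduce LE AE BE sK'.
Qed.

Lemma path_connected_trmx n m p q (A : 'M[R]_n) (B : 'M[R]_(n, m))
    (D : 'M[R]_(p, n)) :
  path_connected R (stabilizing_controllers A B D q) ->
  path_connected R (stabilizing_controllers A^T D^T B^T q).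
Proof.
move=> pc x y /stabilizing_trmx + /stabilizing_trmx; rewrite !trmxK => Sx Sy.
have [f [cf f0 f1 Sf]] := pc _ _ Sx Sy; exists (fun t => (f t)^T); split.
- have {}cf : mxcontinuous (f : subspace `[0 : R, 1] -> _) by exact/mxcontinuousP.
  exact/mxcontinuousP/(mxcontinuous_trmx cf).
- by rewrite f0 trmxK.
- by rewrite f1 trmxK.
- by move=> t t01; apply: stabilizing_trmx; exact: Sf.
Qed.

End Main.

Theorem theorem3p3 (R : realType) (n m p : nat)
  (hn : (1 <= n)%N) (hm : (1 <= m)%N) (hp : (1 <= p)%N)
  (A : 'M[R]_n) (B : 'M[R]_(n, m)) (C : 'M[R]_(p, n))
  (W : 'M[R]_n) (V : 'M[R]_p) (Q : 'M[R]_n) (Rw : 'M[R]_m)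
  (hW : possemidef W) (hV : posdef V) (hQ : possemidef Q) (hRw : posdef Rw)
  (Whalf Qhalf : 'M[R]_n)
  (hWhalf : is_psd_sqrt W Whalf) (hQhalf : is_psd_sqrt Q Qhalf)
  (hAB : controllable A B) (hAW : controllable A Whalf)
  (hCA : observable C A) (hQA : observable Qhalf A) :
  (stabilizing_controllers A B C n.-1 !=set0 ->
     path_connected R (stabilizing_controllers A B C n)) /\
  (m = 1%N \/ p = 1%N ->
     (path_connected R (stabilizing_controllers A B C n) <->
      stabilizing_controllers A B C n.-1 !=set0)).
Proof.
case: n => [//|n] in hn A B C W Q hW hQ Whalf Qhalf hWhalf hQhalf hAB hAW hCA hQA *.
have part1 := @path_connected_of_reduced R n m p A B C.
split=> // mp; split=> //; have [K SK] := stabilizing_nonempty hAB hCA.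
case: mp => [m1|p1] pc.
  (* Transposition exchanges inputs and outputs, so a single input becomes a single output. *)
  move: B hAB K SK pc {part1}; rewrite m1 => B _ K SK /path_connected_trmx pc.
  have [|K' /stabilizing_trmx] := reduced_of_path_connected _ pc.
    by exists K^T; exact: stabilizing_trmx.
  by rewrite !trmxK => SK'; exists K'^T.
move: C hCA K SK pc {part1 V hV}; rewrite p1 => C _ K SK.
by apply: reduced_of_path_connected; exists K.
Qed.
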